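(* Let $S$ be a CSP with parameters $w,\ell,W,q,s$ and type $\mathcal R$, and let $m$ be the number of constraints of the instances. (a) If $\mathrm{E}(S)$ is solvable in time $T$, then $\mathrm{H}(S)_{\{\mathcal R\}}$ is solvable in time $O\big((T+|[\ell]^{(q)}|\cdot\mathrm{comp}(\mathcal R))\cdot m\cdot|[\ell]^{(q)}|\big)$. (b) If $\mathrm{H}(S)_{\{\mathcal R\}}$ is solvable in time $T$, then $\mathrm{E}(S)$ is solvable in time $O\big(T\cdot m\cdot\mathrm{comp}(\mathrm{E}(\mathcal R))\big)$.
   Context: Notation: $[k]=\{1,\dots,k\}$, $\langle k\rangle=\{0,1,\dots,k-1\}$. A constraint satisfaction problem (CSP) $S$ is specified, for every positive integer $n$, by parameters: alphabet size $w=w(n)$, assignment length $\ell=\ell(n)$, a set of admissible assignments $W\subseteq\langle w\rangle^{\ell}$ that is symmetric (closed under permuting coordinates), arity $q=q(n)$, number of relations $s=s(n)$; and by its type, a set $\mathcal R=\{R_1,\dots,R_s\}$ of $q$-ary relations $R_k\subseteq W_q$, where $W_q=\{u\in\langle w\rangle^q: uv\in W\text{ for some }v\in\langle w\rangle^{\ell-q}\}$. Let $[\ell]^{(q)}$ denote the set of $q$-tuples of pairwise distinct elements of $[\ell]$. An instance is a set $\mathcal C=\{C_1,\dots,C_m\}$ of constraints over variables $\mathcal V=\{x_1,\dots,x_\ell\}$, each of the form $R_k(x_{j_1},\dots,x_{j_q})$ with $k\in[s]$, $(j_1,\dots,j_q)\in[\ell]^{(q)}$; $a\in W$ satisfies it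 if $(a_{j_1},\dots,a_{j_q})\in R_k$, and satisfies $\mathcal C$ if it satisfies all constraints. Solving $S$ means: output a satisfying assignment in $W$ if one exists, and ''no'' otherwise. Hidden CSP: for $\mathcal U\subseteq\{\mathcal R,\mathcal V\}$, $\mathrm{H}(S)_{\mathcal U}$ has the parameters and type of $S$, but the algorithm is given only $n$ and $m$; the instance is accessible only through a $\mathcal U$-revealing oracle: on a query $a\in W$ it answers ''yes'' if $a$ satisfies $\mathcal C$; otherwise it returns the index $j$ of some (arbitrarily chosen) violated constraint $C_j=R_k(x_{j_1},\dots,x_{j_q})$, together with $k$ if $\mathcal R\in\mathcal U$ and $(j_1,\dots,j_q)$ if $\mathcal V\in\mathcal U$. An algorithm solves $\mathrm{H}(S)_{\mathcal U}$ if for all $n,m$, every instance and every $\mathcal U$-revealing oracle for it, it outputs a satisfying assignment if one exists and ''no'' otherwise; complexity is worst-case number of steps, each oracle query counting one step. $\mathrm{comp}(R)$ is the time complexity of deciding membership in $R$, and $\mathrm{comp}(\mathcal R)=\max_{R\in\mathcal R}\mathrm{comp}(R)$. For $R\in\mathcal R$ and $(j_1,\dots,j_q)\in[\ell]^{(q)}$, $R^{(j_1,\dots,j_q)}=\{a\in W:(a_{j_1},\dots,a_{j_q})\in R\}$ (an $\ell$-ary relation); for $I\subseteq[\ell]^{(q)}$, $R^I=\bigcup_{(j_1,\dots,j_q)\in I}R^{(j_1,\dots,j_q)}$. The arity extension is $\mathrm{E}(\mathcal R)=\bigcup_{R\in\mathcal R}\{R^I: I\subseteq[\ell]^{(q)}\}$,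 and $\mathrm{E}(S)$ is the CSP with the same parameters as $S$ except that the arity is $\ell$, and with type $\mathrm{E}(\mathcal R)$. *)

(* Defs.v *)
From mathcomp Require Import all_boot perm.

Set Implicit Arguments.
Unset Strict Implicit.
Unset Printing Implicit Defensive.

(** * Constraint satisfaction problems *)

(* Tuples of pairwise distinct indices; [l] is coded as 'I_l = {0, .., l-1}
   and <w> as 'I_w. *)
Definition dtuple (l q : nat) := {t : q.-tuple 'I_l | uniq t}.

Definition vals (w l : nat) (a : l.-tuple 'I_w) : seq nat := map val a.

Definition project (w l q : nat) (a : l.-tuple 'I_w) (t : dtuple l q) :
    q.-tuple 'I_w :=
  [tuple tnth a (tnth (val t) i) | i < q].

(* W_q: the tuples of <w>^q that extend to an element of W *)
Definition prefixes (w l q : nat) (W : {set l.-tuple 'I_w}) :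
    {set q.-tuple 'I_w} :=
  [set u : q.-tuple 'I_w | [exists a in W, take q (val a) == val u]].

Definition symmetric_set (w l : nat) (W : {set l.-tuple 'I_w}) : Prop :=
  forall (p : {perm 'I_l}) (a : l.-tuple 'I_w),
    a \in W -> [tuple tnth a (p i) | i < l] \in W.

(* The parameters and the type of a CSP for one fixed value of n.  The type is
   a set of s relations, so its members R_0, .., R_(s-1) are distinct. *)
Record level := Level {
  alph : nat;
  len : nat;
  arity : nat;
  nrel : nat;
  adm : {set len.-tuple 'I_alph};
  rel : 'I_nrel -> {set arity.-tuple 'I_alph};
  alph_gt0 : 0 < alph;
  arity_le : arity <= len;
  adm_sym : symmetric_set adm;
  rel_inj : injective rel;
  rel_adm : forall k, rel k \subset prefixes arity adm
}.

(* Only the values at positive n are used. *)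
Definition csp := nat -> level.

Definition assignment (L : level) := (len L).-tuple 'I_(alph L).

(* the constraint R_k(x_t) is coded by the pair (k, t) *)
Definition constraint (L : level) :=
  ('I_(nrel L) * dtuple (len L) (arity L))%type.

(* m indexed constraints, possibly with repetitions *)
Definition instance (L : level) (m : nat) := 'I_m -> constraint L.

Definition sat_constraint (L : level) (c : constraint L) (a : assignment L) :
    bool :=
  project a c.2 \in rel c.1.

Definition satisfies (L : level) m (C : instance L m) (a : assignment L) :
    Prop :=
  a \in adm L /\ forall j, sat_constraint (C j) a.

Definition rel_set (L : level) : {set {set (arity L).-tuple 'I_(alph L)}} :=
  [set rel k | k : 'I_(nrel L)].

Section ArityExtension.
Variable L : level.

Definition rel_at (R : {set (arity L).-tuple 'I_(alph L)})
    (t : dtuple (len L) (arity L)) : {set assignment L} :=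
  [set a in adm L | project a t \in R].

Definition rel_union (R : {set (arity L).-tuple 'I_(alph L)})
    (I : {set dtuple (len L) (arity L)}) : {set assignment L} :=
  \bigcup_(t in I) rel_at R t.

Definition ext_rel_set : {set {set assignment L}} :=
  \bigcup_(R in rel_set L)
    [set rel_union R I | I : {set dtuple (len L) (arity L)}].

Definition ext_rel (k : 'I_#|ext_rel_set|) : {set (len L).-tuple 'I_(alph L)} :=
  enum_val k.

Lemma ext_rel_inj : injective ext_rel.
Proof. exact: enum_val_inj. Qed.

Lemma ext_rel_adm k : ext_rel k \subset prefixes (len L) (adm L).
Proof.
rewrite /ext_rel; have /bigcupP[R _ /imsetP[I _ ->]] := enum_valP k.
apply/bigcupsP => t _; apply/subsetP => a; rewrite !inE => /andP[Wa _].
by apply/existsP; exists a; rewrite Wa take_oversize ?size_tuple /=.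
Qed.

Definition ext_level : level :=
  Level (alph_gt0 L) (leqnn (len L)) (@adm_sym L) ext_rel_inj ext_rel_adm.

Lemma ext_level_rel_set : rel_set ext_level = ext_rel_set.
Proof.
apply/setP => R; apply/imsetP/idP => [[k _ ->]|ER]; first exact: enum_valP.
by exists (enum_rank_in ER R); rewrite //= /ext_rel enum_rankK_in.
Qed.

End ArityExtension.

Definition ext_csp (S : csp) : csp := fun n => ext_level (S n).

(** * Machine model *)

(* Algorithms are programs of a unit-cost random-access machine with addition,
   truncated subtraction and comparison.  The memory consists of named arrays
   of natural numbers, all initially 0; the cell of array X with the empty
   subscript list is the scalar variable X, and subscripts are given by scalar
   variables.  There is a read-only random-access input, a write-only output
   tape, and an oracle. *)

Definition store := nat -> seq nat -> nat.

Variant arith := Add | Sub | Leq.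

Inductive prog :=
| Skip
| Const (x c : nat)                 (* x := c *)
| Op (o : arith) (x y z : nat)      (* x := y o z *)
| Get (x X : nat) (ys : seq nat)   (* x := X[ys] *)
| Put (X : nat) (ys : seq nat) (x : nat)   (* X[ys] := x *)
| Read (x f : nat) (ys : seq nat)   (* x := input field f at [ys] *)
| Reset (X : nat)                   (* all cells of X become 0 *)
| Emit (x : nat)                    (* append x to the output *)
| Query (Y X x : nat)               (* Y := answer to X[0], .., X[x-1] *)
| Seq (p1 p2 : prog)
| If (x : nat) (p1 p2 : prog)       (* p2 is executed when x = 0 *)
| While (x : nat) (p : prog).       (* stops when x = 0 *)

Definition arith_val (o : arith) (a b : nat) : nat :=
  match o with
  | Add => a + b
  | Sub => a - b
  | Leq => a <= b
  end.

(* The answer may depend on the previous queries (most recent first), so that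
   adaptive oracles are covered; None means that the query is illegal, and then
   the machine is stuck. *)
Definition oracle := seq (seq nat) -> seq nat -> option (seq nat).

Definition no_oracle : oracle := fun _ _ => None.

Record state := State {
  mem : store;
  hist : seq (seq nat);
  outp : seq nat
}.

Definition init_state : state := State (fun _ _ => 0) [::] [::].

Definition scalar (s : state) (x : nat) : nat := mem s x [::].

Definition subscripts (s : state) (ys : seq nat) : seq nat := map (scalar s) ys.

Definition set_cell (s : state) (X : nat) (addr : seq nat) (v : nat) : state :=
  State (fun X' addr' =>
           if (X' == X) && (addr' == addr) then v else mem s X' addr')
        (hist s) (outp s).

Definition set_array (s : state) (X : nat) (g : seq nat -> nat) : state :=
  State (fun X' => if X' == X then g else mem s X') (hist s) (outp s).

(* the array with one-subscript cells v_0, v_1, .. and 0 elsewhere *)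
Definition array_of (v : seq nat) (addr : seq nat) : nat :=
  if addr is [:: i] then nth 0 v i else 0.

Definition query_word (s : state) (X x : nat) : seq nat :=
  [seq mem s X [:: i] | i <- iota 0 (scalar s x)].

(* [exec O inp p s t s']: started in state s, the program p stops in state s'
   after t steps; every executed instruction, test and query is one step. *)
Inductive exec (O : oracle) (inp : store) :
    prog -> state -> nat -> state -> Prop :=
| ExecSkip s : exec O inp Skip s 1 s
| ExecConst x c s : exec O inp (Const x c) s 1 (set_cell s x [::] c)
| ExecOp o x y z s :
    exec O inp (Op o x y z) s 1
      (set_cell s x [::] (arith_val o (scalar s y) (scalar s z)))
| ExecGet x X ys s :
    exec O inp (Get x X ys) s 1
      (set_cell s x [::] (mem s X (subscripts s ys)))
| ExecPut X ys x s :
    exec O inp (Put X ys x) s 1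
      (set_cell s X (subscripts s ys) (scalar s x))
| ExecRead x f ys s :
    exec O inp (Read x f ys) s 1
      (set_cell s x [::] (inp f (subscripts s ys)))
| ExecReset X s : exec O inp (Reset X) s 1 (set_array s X (fun _ => 0))
| ExecEmit x s :
    exec O inp (Emit x) s 1 (State (mem s) (hist s) (rcons (outp s) (scalar s x)))
| ExecQuery Y X x s ans :
    O (hist s) (query_word s X x) = Some ans ->
    exec O inp (Query Y X x) s 1
      (set_array (State (mem s) (query_word s X x :: hist s) (outp s))
                 Y (array_of ans))
| ExecSeq p1 p2 s1 s2 s3 t1 t2 :
    exec O inp p1 s1 t1 s2 -> exec O inp p2 s2 t2 s3 ->
    exec O inp (Seq p1 p2) s1 (t1 + t2) s3
| ExecIfTrue x p1 p2 s t s' :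
    scalar s x != 0 -> exec O inp p1 s t s' ->
    exec O inp (If x p1 p2) s t.+1 s'
| ExecIfFalse x p1 p2 s t s' :
    scalar s x = 0 -> exec O inp p2 s t s' ->
    exec O inp (If x p1 p2) s t.+1 s'
| ExecWhileEnd x p s :
    scalar s x = 0 -> exec O inp (While x p) s 1 s
| ExecWhileLoop x p s1 s2 s3 t1 t2 :
    scalar s1 x != 0 -> exec O inp p s1 t1 s2 ->
    exec O inp (While x p) s2 t2 s3 ->
    exec O inp (While x p) s1 (t1 + t2).+1 s3.

Lemma exec_det O inp p s t1 s1 t2 s2 :
  exec O inp p s t1 s1 -> exec O inp p s t2 s2 -> t1 = t2 /\ s1 = s2.
Proof.
move=> E1; elim: E1 t2 s2 => {p s t1 s1}; try by move=> *; match goal with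
  H : exec _ _ _ _ _ _ |- _ => inversion H end.
- by move=> Y X x s ans Oa t2 s2 E; inversion E; subst; split=> //; congruence.
- move=> p1 p2 s1 s2 s3 t1 t2 _ IH1 _ IH2 t s E; inversion E; subst.
  match goal with H : exec _ _ p1 _ _ _ |- _ => have [? ?] := IH1 _ _ H end.
  subst.
  by match goal with H : exec _ _ p2 _ _ _ |- _ =>
    have [-> ->] := IH2 _ _ H end.
- move=> x p1 p2 s t s' /eqP nz _ IH t2 s2 E; inversion E; subst => //.
  by match goal with H : exec _ _ p1 _ _ _ |- _ =>
    have [-> ->] := IH _ _ H end.
- move=> x p1 p2 s t s' z _ IH t2 s2 E; inversion E; subst.
    by match goal with H : is_true (_ != _) |- _ => rewrite z in H end.
  by match goal with H : exec _ _ p2 _ _ _ |- _ =>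
    have [-> ->] := IH _ _ H end.
- move=> x p s z t2 s2 E; inversion E; subst => //.
  by match goal with H : is_true (_ != _) |- _ => rewrite z in H end.
- move=> x p s1 s2 s3 t1 t2 /eqP nz _ IH1 _ IH2 t s E; inversion E; subst => //.
  match goal with H : exec _ _ p _ _ _ |- _ => have [? ?] := IH1 _ _ H end.
  subst.
  by match goal with H : exec _ _ (While _ _) _ _ _ |- _ =>
    have [-> ->] := IH2 _ _ H end.
Qed.

Definition runs_within (O : oracle) (inp : store) (p : prog) (T : nat)
    (out : seq nat) : Prop :=
  exists t s, [/\ exec O inp p init_state t s, t <= T & outp s = out].

(** * Presentation of CSPs to algorithms *)

(* How the parameters and the names of relations are given to a machine:
   [pdesc k d] means that the arrays d 0, d 1, .. describe the relation k. *)
Record presentation (S : csp) := Presentation {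
  pparams : nat -> seq nat;
  pdesc : forall n, 'I_(nrel (S n)) -> store -> Prop
}.

Definition csp_params (S : csp) (n : nat) : seq nat :=
  [:: n; alph (S n); len (S n); arity (S n); nrel (S n)].

Definition by_index (S : csp) : presentation S :=
  @Presentation S (csp_params S) (fun n k d => d 0 [::] = k).

(* A relation of E(S) is given as some R_k^I: by the index k and a listing of
   the elements of I without repetition, in arbitrary order. *)
Definition lists_ext_rel (L : level) (R : {set assignment L}) (d : store) :
    Prop :=
  exists (k : 'I_(nrel L)) (e : seq (dtuple (len L) (arity L))),
    [/\ R = rel_union (rel k) [set t in e], uniq e,
        d 0 [::] = k, d 1 [:: 0] = size e &
        forall (r : 'I_(size e)) (i : 'I_(arity L)),
          d 2 [:: val r; val i] = tnth (val (tnth (in_tuple e) r)) i].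

Definition by_listing (S : csp) : presentation (ext_csp S) :=
  @Presentation (ext_csp S) (csp_params S)
    (fun n k d => lists_ext_rel (ext_rel k) d).

Definition enc_params (v : seq nat) (inp : store) : Prop :=
  forall i, i < size v -> inp 0 [:: i] = nth 0 v i.

(* Input field 0 holds the parameters and m, field 1 the variables of the
   constraints, and the fields from 2 on the descriptions of their relations;
   cells that are not mentioned are arbitrary. *)
Definition enc_instance (S : csp) (P : presentation S) n m
    (C : instance (S n) m) (inp : store) : Prop :=
  [/\ enc_params (rcons (pparams P n) m) inp,
      forall (j : 'I_m) (i : 'I_(arity (S n))),
        inp 1 [:: val j; val i] = tnth (val (C j).2) i &
      forall j : 'I_m,
        pdesc P (C j).1 (fun f addr => inp f.+2 (val j :: addr))].

Definition enc_membership (S : csp) (P : presentation S) n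
    (k : 'I_(nrel (S n))) (u : (arity (S n)).-tuple 'I_(alph (S n)))
    (inp : store) : Prop :=
  [/\ enc_params (pparams P n) inp,
      forall i : 'I_(arity (S n)), inp 1 [:: val i] = tnth u i &
      pdesc P k (fun f addr => inp f.+2 addr)].

(** * Time complexity of the tasks *)

(* "no" is the output 0; an assignment a is output as 1, a_0, .., a_(l-1) *)
Definition correct_output (L : level) m (C : instance L m) (out : seq nat) :
    Prop :=
  (exists2 a, satisfies C a & out = 1 :: vals a) \/
  ((forall a, ~ satisfies C a) /\ out = [:: 0]).

Definition solvable_in_time (S : csp) (P : presentation S)
    (T : nat -> nat -> nat) : Prop :=
  exists A : prog, forall n m, 0 < n -> 0 < m ->
    forall (C : instance (S n) m) (inp : store),
      enc_instance P C inp ->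
      exists2 out, runs_within no_oracle inp A (T n m) out &
                   correct_output C out.

(* comp of the type of S is bounded by c(n): membership of a tuple over the
   alphabet in the relation R_k is decided within c(n) steps for every k *)
Definition comp_within (S : csp) (P : presentation S) (c : nat -> nat) : Prop :=
  exists D : prog, forall n, 0 < n ->
    forall (k : 'I_(nrel (S n))) (u : (arity (S n)).-tuple 'I_(alph (S n)))
           (inp : store),
      enc_membership P k u inp ->
      runs_within no_oracle inp D (c n) [:: (u \in rel k) : nat].

(** * Hidden CSPs *)

(* None is "yes", and Some j points to the violated constraint C_j *)
Definition truthful (L : level) m (C : instance L m) (a : assignment L)
    (ans : option 'I_m) : Prop :=
  match ans with
  | None => satisfies C a
  | Some j => ~~ sat_constraint (C j) a
  end.

(* the flags tell whether the relation index and the variables are revealed *)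
Definition enc_answer (showR showV : bool) (L : level) m (C : instance L m)
    (ans : option 'I_m) : seq nat :=
  match ans with
  | None => [:: 1]
  | Some j =>
      [:: 0; val j] ++ (if showR then [:: val (C j).1] else [::])
        ++ (if showV then vals (val (C j).2) else [::])
  end.

Definition revealing_oracle (showR showV : bool) (L : level) m
    (C : instance L m) (O : oracle) : Prop :=
  forall (h : seq (seq nat)) (x : seq nat),
    (forall a : assignment L, a \in adm L -> x = vals a ->
       exists2 ans, truthful C a ans &
                    O h x = Some (enc_answer showR showV C ans)) /\
    ((forall a : assignment L, a \in adm L -> x <> vals a) -> O h x = None).

Definition hidden_solvable_in_time (showR showV : bool) (S : csp)
    (T : nat -> nat -> nat) : Prop :=
  exists A : prog, forall n m, 0 < n -> 0 < m ->
    forall (C : instance (S n) m) (O : oracle) (inp : store),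
      revealing_oracle showR showV C O ->
      enc_params (rcons (csp_params S n) m) inp ->
      exists2 out, runs_within O inp A (T n m) out & correct_output C out.

(* |[l]^(q)| as a function of n *)
Definition ntuples (S : csp) (n : nat) : nat :=
  #|{: dtuple (len (S n)) (arity (S n))}|.

(* Main.v *)
From mathcomp Require Import all_boot zify perm.
Require Import Defs.

Set Implicit Arguments.
Unset Strict Implicit.
Unset Printing Implicit Defensive.

(* (a) For every revealed constraint, keep the list of the tuples that it may
   still have; at first these are all tuples.  Solve the instance of E(S) in
   which a constraint asks for its relation at one of its remaining tuples.  If
   there is no solution, then the hidden instance has none.  Otherwise query the
   solution: a violated constraint is either revealed for the first time, or
   loses at least one tuple, so there are at most m (N + 1) such rounds, where N
   is the number of tuples.  A constraint that is not yet revealed is presented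
   as a copy of a revealed one.  As long as there is none, R_0 with all tuples is
   used, and then R_1 if R_0 is empty: two relations of the type are distinct,
   so they are not both empty.

   (b) Run the hidden algorithm, and answer a query a with a constraint of the
   E(S)-instance that a violates, found with the membership test.  If the lists I_j
   are nonempty, such answers are truthful for every hidden instance obtained by
   choosing one tuple in each I_j, and the E(S)-instance is satisfiable if and
   only if one of these is.  The simulation is aborted when a query violates
   nothing, as that query is a solution.  Writing down a solution is within the
   time bound since the hidden algorithm has to output one as well.

   Both simulations run in time linear in that of the simulated program because
   the inputs of the subroutines are never built but computed at each read. *)

(** * Weakest preconditions with step counts *)

Section WeakestPrecondition.
Variables (O : oracle) (inp : store).

(** Total correctness: a stuck or diverging run yields no witness, so termination and the legality
    of all queries are part of the claim. The postcondition receives the number of steps. *)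
Definition wp (p : prog) (s : state) (Q : nat -> state -> Prop) : Prop :=
  exists t s', exec O inp p s t s' /\ Q t s'.

Lemma wp_mono p s (Q Q' : nat -> state -> Prop) :
  wp p s Q -> (forall t s', Q t s' -> Q' t s') -> wp p s Q'.
Proof. by move=> [t [s' [e q]]] h; exists t, s'; split=> //; apply: h. Qed.

Lemma wp_skip s (Q : nat -> state -> Prop) : Q 1 s -> wp Skip s Q.
Proof. by exists 1, s; split=> //; constructor. Qed.

Lemma wp_const x c s (Q : nat -> state -> Prop) :
  Q 1 (set_cell s x [::] c) -> wp (Const x c) s Q.
Proof. by move=> q; do 2 eexists; split; first constructor. Qed.

Lemma wp_op o x y z s (Q : nat -> state -> Prop) :
  Q 1 (set_cell s x [::] (arith_val o (scalar s y) (scalar s z))) ->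
  wp (Op o x y z) s Q.
Proof. by move=> q; do 2 eexists; split; first constructor. Qed.

Lemma wp_get x X ys s (Q : nat -> state -> Prop) :
  Q 1 (set_cell s x [::] (mem s X (subscripts s ys))) -> wp (Get x X ys) s Q.
Proof. by move=> q; do 2 eexists; split; first constructor. Qed.

Lemma wp_put X ys x s (Q : nat -> state -> Prop) :
  Q 1 (set_cell s X (subscripts s ys) (scalar s x)) -> wp (Put X ys x) s Q.
Proof. by move=> q; do 2 eexists; split; first constructor. Qed.

Lemma wp_read x f ys s (Q : nat -> state -> Prop) :
  Q 1 (set_cell s x [::] (inp f (subscripts s ys))) -> wp (Read x f ys) s Q.
Proof. by move=> q; do 2 eexists; split; first constructor. Qed.

Lemma wp_reset X s (Q : nat -> state -> Prop) :
  Q 1 (set_array s X (fun _ => 0)) -> wp (Reset X) s Q.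
Proof. by move=> q; do 2 eexists; split; first constructor. Qed.

Lemma wp_emit x s (Q : nat -> state -> Prop) :
  Q 1 (State (mem s) (hist s) (rcons (outp s) (scalar s x))) ->
  wp (Emit x) s Q.
Proof. by move=> q; do 2 eexists; split; first constructor. Qed.

Lemma wp_query Y X x s ans (Q : nat -> state -> Prop) :
  O (hist s) (query_word s X x) = Some ans ->
  Q 1 (set_array (State (mem s) (query_word s X x :: hist s) (outp s))
                 Y (array_of ans)) ->
  wp (Query Y X x) s Q.
Proof. by move=> oa q; do 2 eexists; split; first by constructor; apply: oa. Qed.

Lemma wp_seq p1 p2 s (Q : nat -> state -> Prop) :
  wp p1 s (fun t1 s1 => wp p2 s1 (fun t2 => Q (t1 + t2))) ->
  wp (Seq p1 p2) s Q.
Proof.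
move=> [t1 [s1 [e1 [t2 [s2 [e2 q]]]]]]; exists (t1 + t2), s2; split=> //.
exact: ExecSeq e1 e2.
Qed.

Lemma wp_if x p1 p2 s (Q : nat -> state -> Prop) :
  (scalar s x != 0 -> wp p1 s (fun t => Q t.+1)) ->
  (scalar s x = 0 -> wp p2 s (fun t => Q t.+1)) ->
  wp (If x p1 p2) s Q.
Proof.
move=> h1 h2; case: (eqVneq (scalar s x) 0) => [z|nz].
  by have [t [s' [e q]]] := h2 z; exists t.+1, s'; split=> //; constructor.
by have [t [s' [e q]]] := h1 nz; exists t.+1, s'; split=> //; constructor.
Qed.

(** The index of [J] bounds the number of rounds that remain. A round costs at most [B] steps and
    one test; the last 1 is the test that ends the loop. *)
Lemma wp_while x p (J : nat -> state -> Prop) B n s (Q : nat -> state -> Prop) :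
  (forall n s, J n s -> scalar s x != 0 ->
     0 < n /\ wp p s (fun t s' => t <= B /\ J n.-1 s')) ->
  J n s ->
  (forall t n' s', t <= n * B.+1 + 1 -> J n' s' -> scalar s' x = 0 -> Q t s') ->
  wp (While x p) s Q.
Proof.
move=> hb; elim: n s Q => [|n IH] s Q Js hq.
  case: (eqVneq (scalar s x) 0) => [z|nz].
    by exists 1, s; split; [exact: ExecWhileEnd | apply: (hq _ 0)].
  by have [] := hb _ _ Js nz.
case: (eqVneq (scalar s x) 0) => [z|nz].
  by exists 1, s; split; [exact: ExecWhileEnd | apply: (hq _ n.+1) => //; lia].
have [_ [t1 [s1 [e1 [t1B J1]]]]] := hb _ _ Js nz.
have [|t2 [s2 [e2 q2]]] := IH s1 (fun t => Q (t1 + t).+1) J1.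
  move=> t n' s' tle J' z; apply: (hq _ n') => //; lia.
by exists (t1 + t2).+1, s2; split=> //; exact: ExecWhileLoop e1 e2.
Qed.

(** A loop can only test for zero, so a copy [d] of the bound counts down while [i] counts up for
    the body. *)
Definition For (one i d n : nat) (body : prog) : prog :=
  Seq (Get d n [::]) (Seq (Const i 0)
    (While d (Seq body (Seq (Op Add i i one) (Op Sub d d one))))).

(** Two counter updates and one test add 3 steps to each round; the two initial assignments and the
    last test are the other 3. The invariant is required of the state after the counter updates. *)
Lemma wp_for one i d n body (J : nat -> state -> Prop) B N s
    (Q : nat -> state -> Prop) :
  [&& i != d, i != one & d != one] ->
  scalar s one = 1 -> scalar s n = N ->
  J 0 (set_cell (set_cell s d [::] N) i [::] 0) ->
  (forall k s, k < N -> J k s ->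
     scalar s i = k -> scalar s d = N - k -> scalar s one = 1 ->
     wp body s (fun t s' =>
       [/\ t <= B, scalar s' i = k, scalar s' d = N - k, scalar s' one = 1 &
           J k.+1 (set_cell (set_cell s' i [::] k.+1) d [::] (N - k.+1))])) ->
  (forall t s', t <= N * (B + 3) + 3 -> J N s' -> Q t s') ->
  wp (For one i d n body) s Q.
Proof.
move=> /and3P[id i1 d1] s1 sn J0 hb hq.
apply: wp_seq; apply: wp_get; apply: wp_seq; apply: wp_const.
have di : (d == i) = false by rewrite eq_sym (negPf id).
have oi : (one == i) = false by rewrite eq_sym (negPf i1).
have od : (one == d) = false by rewrite eq_sym (negPf d1).
pose J' r s := [/\ r <= N, J (N - r) s, scalar s i = N - r, scalar s d = r &
                   scalar s one = 1].
apply: (@wp_while _ _ J' (B + 2) N).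
- move=> r s' [rN Jr si sd so] sd0; have r0 : 0 < r by rewrite -sd lt0n.
  split=> //; apply: wp_seq; apply: wp_mono; first apply: (hb (N - r)) => //.
  + by lia.
  + by rewrite sd; lia.
  move=> t s2 [tB s2i s2d s2o Js2]; apply: wp_seq; apply: wp_op; apply: wp_op.
  split; first by lia.
  have -> : arith_val Add (scalar s2 i) (scalar s2 one) = (N - r).+1.
    by rewrite /= s2i s2o addn1.
  set s3 := set_cell s2 _ _ _.
  have -> : arith_val Sub (scalar s3 d) (scalar s3 one) = N - (N - r).+1.
    by rewrite /= /s3 /scalar /= di oi /= -!/(scalar _ _) s2d s2o; lia.
  have e : N - r.-1 = (N - r).+1 by lia.
  split; rewrite ?e //; try lia.
  + by rewrite /scalar /= /s3 /= (negPf id) /= eqxx /=.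
  + by rewrite /scalar /= eqxx /=; lia.
  + by rewrite /scalar /= od /s3 /= oi.
- split; rewrite ?subnn //.
  + by rewrite -[mem s n _]/(scalar s n) sn.
  + by rewrite /scalar /= eqxx.
  + by rewrite /scalar /= di /= eqxx /= -[RHS]sn.
  + by rewrite /scalar /= oi /= od.
- move=> t r s' tle [rN Jr _ sd _] z; apply: hq; first by lia.
  by move: Jr; rewrite -sd z subn0.
Qed.

End WeakestPrecondition.

(** * Programs as subroutines *)

(** All registers and arrays that a run can touch. Their number depends on the program only, so
    clearing them before a call costs a constant. *)
Fixpoint names (p : prog) : seq nat :=
  match p with
  | Skip => [::]
  | Const x _ => [:: x]
  | Op _ x y z => [:: x; y; z]
  | Get x X ys => [:: x, X & ys]
  | Put X ys x => [:: X, x & ys]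
  | Read x _ ys => x :: ys
  | Reset X => [:: X]
  | Emit x => [:: x]
  | Query Y X x => [:: Y; X; x]
  | Seq p1 p2 => names p1 ++ names p2
  | If x p1 p2 => x :: names p1 ++ names p2
  | While x p => x :: names p
  end.

Lemma exec_gt0 O inp p s t s' : exec O inp p s t s' -> 0 < t.
Proof. by elim=> // *; lia. Qed.

Section Embedding.
Variables (nu : nat -> nat) (OUT CNT ONE DONE : nat).
Variables (rd : nat -> nat -> seq nat -> prog) (qr : nat -> nat -> nat -> prog).

(* [p] as a subroutine: names are translated by [nu], the output goes to the
   array OUT of length CNT, inputs and queries are served by [rd] and [qr], and
   a nonzero DONE set by [qr] makes the rest of the program fall through. *)
Fixpoint embed (p : prog) : prog :=
  match p with
  | Skip => Skip
  | Const x c => Const (nu x) c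
  | Op o x y z => Op o (nu x) (nu y) (nu z)
  | Get x X ys => Get (nu x) (nu X) (map nu ys)
  | Put X ys x => Put (nu X) (map nu ys) (nu x)
  | Read x f ys => rd (nu x) f (map nu ys)
  | Reset X => Reset (nu X)
  | Emit x => Seq (Put OUT [:: CNT] (nu x)) (Op Add CNT CNT ONE)
  | Query Y X x => qr (nu Y) (nu X) (nu x)
  | Seq p1 p2 => Seq (embed p1) (If DONE Skip (embed p2))
  | If x p1 p2 => If (nu x) (embed p1) (embed p2)
  | While x p =>
      While (nu x) (Seq (embed p) (If DONE (Const (nu x) 0) Skip))
  end.

Definition resets (V : seq nat) : prog :=
  foldr (fun X p => Seq (Reset (nu X)) p) Skip V.

(** Running times are specified from the all-zero state, while a subroutine is called many times;
    hence its arrays are cleared first. *)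
Definition call (p : prog) : prog :=
  Seq (Const CNT 0) (Seq (resets (names p)) (embed p)).

Definition untouched (prot : pred nat) (s s' : state) : Prop :=
  forall X, prot X -> forall a, mem s' X a = mem s X a.

(** Only the first [size out] cells are described: the buffer is not cleared between calls and may
    hold leftovers of longer outputs. *)
Definition buffered (out : seq nat) (s : state) : Prop :=
  scalar s CNT = size out /\
  forall i, i < size out -> mem s OUT [:: i] = nth 0 out i.

Section Correctness.
Variables (V : seq nat) (prot : pred nat) (s0 : state).

(** Keeps apart the translated names, the output buffer and the names that the caller protects.
    [ONE] and [DONE] are protected because the embedded program reads them. *)
Record layout : Prop := Layout {
  lay_inj : injective nu;
  lay_prot : forall X, ~~ prot (nu X);
  lay_out : forall X, (OUT == nu X) = false;
  lay_cnt : forall X, (CNT == nu X) = false;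
  lay_out_cnt : (OUT == CNT) = false;
  lay_out_prot : ~~ prot OUT;
  lay_cnt_prot : ~~ prot CNT;
  lay_one_prot : prot ONE;
  lay_done_prot : prot DONE
}.

(** Relates a state [s] of the simulated program to a state [s'] of the host. The histories are not
    related, since a simulated query need not be a query of the host. *)
Record sim (s s' : state) : Prop := Sim {
  sim_mem : {in V, forall X a, mem s' (nu X) a = mem s X a};
  sim_buf : buffered (outp s) s';
  sim_prot : untouched prot s0 s';
  sim_outp : outp s' = outp s0
}.

(** Scratch names, which the programs serving inputs and queries may overwrite at will. *)
Definition spare (z : nat) : Prop :=
  [/\ ~~ prot z, z != OUT, z != CNT & forall X, nu X != z].

Hypothesis lay : layout.
Let nu_inj := lay_inj lay.
Let nu_prot := lay_prot lay.
Let nu_out := lay_out lay.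
Let nu_cnt := lay_cnt lay.
Let out_cnt := lay_out_cnt lay.
Let out_prot := lay_out_prot lay.
Let cnt_prot := lay_cnt_prot lay.
Let one_prot := lay_one_prot lay.
Let done_prot := lay_done_prot lay.
Hypothesis one1 : scalar s0 ONE = 1.
Hypothesis done0 : scalar s0 DONE = 0.

Lemma sim_set s s' x a v :
  sim s s' -> sim (set_cell s x a v) (set_cell s' (nu x) a v).
Proof.
move=> [m b u o]; split=> //.
- by move=> X VX a'; rewrite /= inj_eq // m.
- by case: b => c b; split=> [|i il]; rewrite /scalar /= ?nu_cnt ?nu_out //= b.
- move=> X pX a' /=; case: eqP => [e|_]; last exact: u.
  by rewrite e (negPf (nu_prot x)) in pX.
Qed.

Lemma sim_spare s s' z a v : spare z -> sim s s' -> sim s (set_cell s' z a v).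
Proof.
move=> [pz zo zc nz] [m b u o]; split=> //.
- by move=> X VX a'; rewrite /= (negPf (nz X)) m.
- case: b => c b; split=> [|i il]; rewrite /scalar /=.
    by rewrite eq_sym (negPf zc).
  by rewrite [_ == z]eq_sym (negPf zo) b.
- move=> X pX a' /=; case: eqP => [e|_]; last exact: u.
  by rewrite e (negPf pz) in pX.
Qed.

Lemma sim_array s s' x g :
  sim s s' -> sim (set_array s x g) (set_array s' (nu x) g).
Proof.
move=> [m b u o]; split=> //.
- by move=> X VX a'; rewrite /= inj_eq //; case: eqP => // _; rewrite m.
- by case: b => c b; split=> [|i il]; rewrite /scalar /= ?nu_cnt ?nu_out //= b.
- move=> X pX a' /=; case: eqP => [e|_]; last exact: u.
  by rewrite e (negPf (nu_prot x)) in pX.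
Qed.

(** Stores are functions; two descriptions of the same memory are compared cell by cell instead of
    being proved equal. *)
Lemma sim_ext s1 s2 s' : sim s1 s' -> {in V, forall X a, mem s2 X a = mem s1 X a} ->
  outp s2 = outp s1 -> sim s2 s'.
Proof.
by move=> [m b u o] e eo; split; rewrite ?eo // => X VX a; rewrite e ?m.
Qed.

Lemma sim_untouched (P : pred nat) s s1 s2 : sim s s1 -> untouched P s1 s2 ->
  (forall X, P (nu X)) -> P OUT -> P CNT -> (forall X, prot X -> P X) ->
  outp s2 = outp s1 -> sim s s2.
Proof.
move=> [m b u o] e Pn Po Pc Pp eo; split; last by rewrite eo.
- by move=> X VX a; rewrite e ?m.
- by case: b => c b; split=> [|i il]; rewrite /scalar e // b.
- by move=> X pX a; rewrite e ?u ?Pp.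
Qed.

Lemma sim_scalar s s' x : sim s s' -> x \in V -> scalar s' (nu x) = scalar s x.
Proof. by move=> h Vx; rewrite /scalar (sim_mem h). Qed.

Lemma sim_subscripts s s' ys : sim s s' -> {subset ys <= V} ->
  subscripts s' (map nu ys) = subscripts s ys.
Proof.
move=> h Vy; rewrite /subscripts -map_comp; apply/eq_in_map => y yy /=.
exact/sim_scalar/Vy.
Qed.

Lemma sim_done s s' : sim s s' -> scalar s' DONE = 0.
Proof. by move=> h; rewrite -done0 /scalar (sim_prot h done_prot). Qed.

Variables (O OH : oracle) (inp inpH : store) (K E : nat).
Variable fin : seq nat -> Prop.

(** Either [t0] steps have been simulated within the budget, or the simulation was aborted at an
    extra cost [E], with [fin] true of the output. The one step left over in [t + 1] pays for the
    test of [DONE] after the first half of a sequence. *)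
Definition sim_post (t0 : nat) (s1 : state) (t : nat) (s' : state) : Prop :=
  (t + 1 <= K * t0 /\ sim s1 s') \/
  [/\ t + 1 <= K * t0 + E, scalar s' DONE != 0 & fin (outp s')].

Hypothesis K4 : 4 <= K.
Hypothesis rd_ok : forall s s' x f (ys : seq nat), sim s s' -> x \in V ->
  {subset ys <= V} -> wp OH inpH (rd (nu x) f (map nu ys)) s'
    (fun t => sim_post 1 (set_cell s x [::] (inp f (subscripts s ys))) t).
Hypothesis qr_ok : forall s s' Y X x ans, sim s s' -> Y \in V -> X \in V ->
  x \in V -> O (hist s) (query_word s X x) = Some ans ->
  wp OH inpH (qr (nu Y) (nu X) (nu x)) s'
    (fun t => sim_post 1
       (set_array (State (mem s) (query_word s X x :: hist s) (outp s))
                 Y (array_of ans)) t).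

(** By induction on the run. After an abort the tests of [DONE] skip what remains and enclosing
    loops clear their conditions; this is paid for by simulated steps that are no longer carried
    out. *)
Lemma embed_ok p s t s1 : exec O inp p s t s1 -> {subset names p <= V} ->
  forall s', sim s s' -> wp OH inpH (embed p) s' (sim_post t s1).
Proof.
elim=> {p s t s1} /=.
- by move=> s _ s' h; apply: wp_skip; left; split=> //; lia.
- move=> x c s _ s' h; apply: wp_const; left; split; [lia | exact: sim_set].
- move=> o x y z s VV s' h; apply: wp_op; left; split; first by lia.
  by rewrite !(sim_scalar h) ?VV ?inE ?eqxx ?orbT //; exact: sim_set.
- move=> x X ys s VV s' h; apply: wp_get; left; split; first by lia.
  rewrite (sim_subscripts h) => [|y yy]; last by rewrite VV ?inE ?yy ?orbT.
  by rewrite (sim_mem h) ?VV ?inE ?eqxx ?orbT //; exact: sim_set.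
- move=> X ys x s VV s' h; apply: wp_put; left; split; first by lia.
  rewrite (sim_subscripts h) => [|y yy]; last by rewrite VV ?inE ?yy ?orbT.
  by rewrite (sim_scalar h) ?VV ?inE ?eqxx ?orbT //; exact: sim_set.
- move=> x f ys s VV s' h; apply: rd_ok => //; first by rewrite VV ?inE ?eqxx.
  by move=> y yy; rewrite VV ?inE ?yy ?orbT.
- move=> X s _ s' h; apply: wp_reset; left; split; [lia | exact: sim_array].
- move=> x s VV s' h; apply: wp_seq; apply: wp_put; apply: wp_op.
  left; split; first by lia.
  rewrite (sim_scalar h) ?VV ?inE //.
  have [m [c b] u o] := h.
  have oo : (ONE == OUT) = false.
    by apply/eqP => e; move: out_prot; rewrite -e one_prot.
  split=> //=.
  + move=> X VX a; rewrite [nu X == CNT]eq_sym nu_cnt [nu X == OUT]eq_sym nu_out.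
    exact: m.
  + split=> [|i]; rewrite /scalar /= !eqxx /= ?size_rcons.
      rewrite andbF /= andbF /=  -![mem s' _ _]/(scalar s' _) c.
      by rewrite [scalar s' ONE](u _ one_prot) -[mem s0 _ _]/(scalar s0 _) one1 addn1.
    rewrite [_ == CNT]out_cnt /= eqseq_cons andbT ltnS nth_rcons [mem s' CNT _]c.
    by case: ltngtP => // /b.
  + move=> X pX a /=.
    have /negPf -> : X != CNT by apply: contraTneq pX => ->.
    have /negPf -> : X != OUT by apply: contraTneq pX => ->.
    exact: u.
- move=> Y X x s ans oa VV s' h; apply: qr_ok => //; rewrite VV ?inE ?eqxx ?orbT //.
- move=> p1 p2 s s1 s2 t1 t2 e1 IH1 e2 IH2 VV s' h; apply: wp_seq.
  (* The second half takes at least one step, and its budget covers falling through after an abort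
     in the first half. *)
  have t2p := exec_gt0 e2.
  have V1 : {subset names p1 <= V} by move=> x xp; rewrite VV // mem_cat xp.
  apply: wp_mono; first exact: IH1 V1 _ h.
  move=> u s1' [[tu h1]|[tu d f]]; apply: wp_if.
  + by rewrite (sim_done h1).
  + move=> _; apply: wp_mono.
      by apply: IH2 h1 => x xp; rewrite VV // mem_cat xp orbT.
    move=> u2 s2' [[tu2 h2]|[tu2 d f]]; [left|right]; split=> //; lia.
  + by move=> _; apply: wp_skip; right; split=> //; nia.
  + by move=> z; rewrite z in d.
- move=> x p1 p2 s t s1 nz e IH VV s' h.
  have sx := sim_scalar h (VV x (mem_head _ _)).
  apply: wp_if => [_|z]; last by rewrite -sx z in nz.
  apply: wp_mono.
    by apply: IH h => y yp; rewrite VV // inE mem_cat yp orbT.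
  by move=> u s2' [[tu h2]|[tu d f]]; [left|right]; split=> //; lia.
- move=> x p1 p2 s t s1 z e IH VV s' h.
  have sx := sim_scalar h (VV x (mem_head _ _)).
  apply: wp_if => [nz|_]; first by rewrite sx z in nz.
  apply: wp_mono.
    by apply: IH h => y yp; rewrite VV // inE mem_cat yp !orbT.
  by move=> u s2' [[tu h2]|[tu d f]]; [left|right]; split=> //; lia.
- move=> x p s z VV s' h.
  exists 1, s'; split; first apply: ExecWhileEnd.
    by rewrite (sim_scalar h) // VV ?mem_head.
  by left; split=> //; lia.
- move=> x p s s1 s2 t1 t2 nz e1 IH1 e2 IH2 VV s' h.
  have nz' : scalar s' (nu x) != 0 by rewrite (sim_scalar h) // VV ?mem_head.
  have [|u1 [s1' [f1 [[tu h1]|[tu d f]]]]] := IH1 _ _ h.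
  + by move=> y yp; rewrite VV // inE yp orbT.
  + have [|u2 [s2' [f2 q]]] := IH2 _ _ h1; first by [].
    exists (u1 + 2 + u2).+1, s2'; split.
      apply: (ExecWhileLoop nz' _ f2); apply: (ExecSeq f1).
      by apply: ExecIfFalse; [exact: sim_done h1 | constructor].
    by case: q => [[tu2 h2]|[tu2 d f]]; [left|right]; split=> //; lia.
  (* An abort inside the body: the condition is set to 0, so the loop ends at its next test. *)
  + pose sf := set_cell s1' (nu x) [::] 0.
    exists (u1 + 2 + 1).+1, sf; split.
      apply: (ExecWhileLoop nz'); first apply: (ExecSeq f1).
        by apply: ExecIfTrue => //; constructor.
      by apply: ExecWhileEnd; rewrite /scalar /= eqxx.
    right; split=> //; first by lia.
    rewrite /scalar /=.
    have -> // : (DONE == nu x) = false.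
    by apply/eqP => e; move: done_prot; rewrite e (negPf (nu_prot x)).
Qed.

Lemma resets_ok (W : seq nat) s' (Q : nat -> state -> Prop) :
  (forall s1, (forall X, X \in W -> forall a, mem s1 (nu X) a = 0) ->
     (forall X, (X \in map nu W) = false -> forall a, mem s1 X a = mem s' X a) ->
     outp s1 = outp s' -> Q (size W).+1 s1) ->
  wp OH inpH (resets W) s' Q.
Proof.
elim: W s' Q => [|X W IH] s' Q hQ; first by apply: wp_skip; apply: hQ.
apply: wp_seq; apply: wp_reset; apply: IH => s1 z1 k1 o1; apply: hQ => //.
- move=> Y; rewrite inE => /orP[/eqP->|/z1] // a.
  case XW: (X \in W); first exact: z1.
  by rewrite k1 ?mem_map //= eqxx.
- move=> Y; rewrite inE => /norP[/negPf yx yW] a.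
  by rewrite k1 ?(negPf yW) //= yx.
Qed.

Lemma call_ok p t s1 : names p = V -> exec O inp p init_state t s1 ->
  wp OH inpH (call p) s0 (fun t' s' =>
    (t' <= K * t + size V + 2 /\ sim s1 s') \/
    [/\ t' <= K * t + E + size V + 2, scalar s' DONE != 0 & fin (outp s')]).
Proof.
move=> nV e; apply: wp_seq; apply: wp_const; apply: wp_seq.
apply: resets_ok => // s2 z2 k2 o2.
have n2 X : (forall Y, (X == nu Y) = false) -> forall a,
    mem s2 X a = mem (set_cell s0 CNT [::] 0) X a.
  by move=> h a; apply/k2/negP => /mapP[Y _ /eqP]; rewrite h.
apply: wp_mono.
  apply: (embed_ok e); rewrite ?nV //; split=> //.
  - by move=> X VX a; rewrite z2 ?nV.
  - by split=> //; rewrite /scalar n2 //= eqxx.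
  - move=> X pX a; rewrite n2 /=.
      by have /negPf -> : X != CNT by apply: contraTneq pX => ->.
    by move=> Y; apply: contraTF pX => /eqP ->.
by move=> u s3 [[tu h]|[tu d f]]; [left|right]; split=> //; rewrite nV; lia.
Qed.

End Correctness.

(** Without an oracle no query is ever executed, so an abort is impossible: [fin] is taken to be
    false and the extra cost is 0. *)
Lemma subroutine_ok prot s0 OH inp inpH K p T out :
  layout prot -> scalar s0 ONE = 1 -> scalar s0 DONE = 0 -> 4 <= K ->
  (forall s s' x f (ys : seq nat), sim (names p) prot s0 s s' ->
     x \in names p -> {subset ys <= names p} ->
     wp OH inpH (rd (nu x) f (map nu ys)) s' (fun t s1 =>
       t + 1 <= K /\ sim (names p) prot s0
         (set_cell s x [::] (inp f (subscripts s ys))) s1)) ->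
  runs_within no_oracle inp p T out ->
  wp OH inpH (call p) s0 (fun t s' =>
    [/\ t <= K * T + size (names p) + 2, buffered out s',
        untouched prot s0 s' & outp s' = outp s0]).
Proof.
move=> lay one1 done0 K4 rd_ok [t [s1 [e tT <-]]].
apply: wp_mono.
  apply: (@call_ok (names p) prot s0 lay one1 done0 no_oracle OH inp inpH K 0
            (fun=> False) K4 _ _ p t s1) => //.
  move=> s s' x f ys h Vx Vy; apply: wp_mono; first exact: (rd_ok _ _ _ f _ h Vx Vy).
  by move=> u s2 [tu h2]; left; rewrite muln1.
move=> u s' [[tu [_ b un o]]|[] //]; split=> //.
by apply: leq_trans tu _; rewrite !leq_add2r leq_mul2l tT orbT.
Qed.

End Embedding.

(** * Projections along tuples of distinct indices *)

Lemma tnth_inj (T : eqType) n (t : n.-tuple T) : uniq t -> injective (tnth t).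
Proof. by move=> /tuple_uniqP. Qed.

Section Composition.
Variables (l q : nat).
Implicit Types (p : dtuple l l) (t : dtuple l q).

(** A constraint of E(S) applies its relation to an arrangement [p] of all variables; position [t]
    of the rearranged assignment is position [comp_dtuple p t] of the original one. *)
Definition comp_tuple p t : q.-tuple 'I_l := map_tuple (tnth (val p)) (val t).

Lemma comp_tuple_uniq p t : uniq (comp_tuple p t).
Proof. by rewrite map_inj_uniq ?(valP t) //; apply/tnth_inj/(valP p). Qed.

Definition comp_dtuple p t : dtuple l q :=
  exist (fun u : q.-tuple 'I_l => uniq u) _ (comp_tuple_uniq p t).

Lemma project_comp w (a : l.-tuple 'I_w) p t :
  project a (comp_dtuple p t) = project (project a p) t.
Proof. by apply: eq_from_tnth => i; rewrite !tnth_mktuple tnth_map. Qed.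

(** An arrangement of all [l] indices is a permutation, so the symmetry of [W] applies. *)
Lemma project_adm w (W : {set l.-tuple 'I_w}) (a : l.-tuple 'I_w) p :
  symmetric_set W -> a \in W -> project a p \in W.
Proof.
move=> symW aW; have := symW (perm (tnth_inj (valP p))) a aW.
by congr (_ \in W); apply: eq_from_tnth => i; rewrite !tnth_mktuple permE.
Qed.

End Composition.

Definition id_dtuple l : dtuple l l :=
  exist (fun u : l.-tuple 'I_l => uniq u) (ord_tuple l) (enum_uniq _).

Lemma project_id w l (a : l.-tuple 'I_w) : project a (id_dtuple l) = a.
Proof. by apply: eq_from_tnth => i; rewrite tnth_mktuple tnth_ord_tuple. Qed.

Lemma rel_unionP (L : level) (R : {set (arity L).-tuple 'I_(alph L)})
    (e : seq (dtuple (len L) (arity L))) a :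
  reflect (a \in adm L /\ exists2 t, t \in e & project a t \in R)
          (a \in rel_union R [set t in e]).
Proof.
apply: (iffP bigcupP) => [[t]|[aW [t te aR]]].
  by rewrite !inE => te /andP[aW aR]; split=> //; exists t.
by exists t; rewrite !inE // aW.
Qed.

Lemma widen_tuple_uniq l q (le : q <= l) : uniq [tuple widen_ord le i | i < q].
Proof.
by rewrite map_inj_uniq ?enum_uniq // => i j /(congr1 val) /= ij; exact: val_inj.
Qed.

Definition prefix_dtuple l q (le : q <= l) : dtuple l q :=
  exist (fun u : q.-tuple 'I_l => uniq u) _ (widen_tuple_uniq le).

Lemma alph_inhab (L : level) k : exists u : k.-tuple 'I_(alph L), true.
Proof. by exists [tuple Ordinal (alph_gt0 L) | i < k]. Qed.

(** * Violated indices, and choosing one tuple for each constraint *)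

Section Blame.
Variable viol : nat -> bool.

(* successor of the last violated index below [k], or 0 *)
Fixpoint blame (k : nat) : nat :=
  if k is k'.+1 then if viol k' then k else blame k' else 0.

Lemma blame0 k : blame k = 0 -> forall j, j < k -> ~~ viol j.
Proof.
elim: k => // k IH /=; case: ifP => // v b j; rewrite ltnS leq_eqVlt.
by case/predU1P=> [->|/(IH b)] //; rewrite v.
Qed.

Lemma blameS k j : blame k = j.+1 -> j < k /\ viol j.
Proof.
elim: k => // k IH /=; case: ifP => [v [<-]|_ /IH[jk vj]]; first by [].
by split=> //; apply: ltnW.
Qed.

End Blame.

Section Choice.
Variables (L : level) (m : nat) (C : instance (ext_level L) m).
Variables (k : 'I_m -> 'I_(nrel L))
  (e : 'I_m -> seq (dtuple (len L) (arity L))).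
Hypothesis Ck : forall j, ext_rel (C j).1 = rel_union (rel (k j)) [set t in e j].

Definition selects (f : 'I_m -> dtuple (len L) (arity L)) : instance L m :=
  fun j => (k j, comp_dtuple (C j).2 (f j)).

(** Violating the union R^I means violating every member of it. An index violated in the
    E(S)-instance is therefore a truthful answer for every hidden instance selected from the
    lists. *)
Lemma ext_violated f j (a : assignment L) : f j \in e j -> a \in adm L ->
  ~~ sat_constraint (C j) a -> ~~ sat_constraint (selects f j) a.
Proof.
move=> fe aW; apply: contra; rewrite /sat_constraint /= project_comp => aR.
rewrite /= Ck; apply/rel_unionP; split; last by exists (f j).
exact/project_adm/aW/adm_sym.
Qed.

Lemma selects_sat f (a : assignment L) : (forall j, f j \in e j) ->
  satisfies (selects f) a -> satisfies C a.
Proof.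
move=> fe [aW aC]; split=> // j; move: (aC j); apply: contraLR.
exact: ext_violated.
Qed.

(** A solution lies in some member of each union; the choice of these members depends on the
    solution. *)
Lemma sat_selects (a : assignment L) : satisfies C a ->
  exists2 f, forall j, f j \in e j & satisfies (selects f) a.
Proof.
move=> [aW aC].
have /fin_all_exists[f fP] : forall j, exists t,
    t \in e j /\ project a (comp_dtuple (C j).2 t) \in rel (k j).
  move=> j; move: (aC j); rewrite /sat_constraint /= Ck.
  by case/rel_unionP=> _ [t te at_]; exists t; rewrite project_comp.
by exists f => [j|]; [case: (fP j) | split=> // j; case: (fP j)].
Qed.

Lemma unsat_empty j (a : assignment L) : e j = [::] -> ~ satisfies C a.
Proof.
move=> e0 [_ /(_ j)]; rewrite /sat_constraint /= Ck e0.
by case/rel_unionP=> _ [].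
Qed.

End Choice.

(** * Symbolic execution and frame conditions *)

Ltac step :=
  lazymatch goal with
  | |- wp _ _ (Seq _ _) _ _ => apply: wp_seq
  | |- wp _ _ Skip _ _ => apply: wp_skip
  | |- wp _ _ (Const _ _) _ _ => apply: wp_const
  | |- wp _ _ (Op _ _ _ _) _ _ => apply: wp_op
  | |- wp _ _ (Get _ _ _) _ _ => apply: wp_get
  | |- wp _ _ (Put _ _ _) _ _ => apply: wp_put
  | |- wp _ _ (Read _ _ _) _ _ => apply: wp_read
  | |- wp _ _ (Reset _) _ _ => apply: wp_reset
  | |- wp _ _ (Emit _) _ _ => apply: wp_emit
  end.

Local Notation off L := [pred X | X \notin L].

Lemma untouched_trans prot s1 s2 s3 :
  untouched prot s1 s2 -> untouched prot s2 s3 -> untouched prot s1 s3.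
Proof. by move=> h1 h2 X pX a; rewrite h2 ?h1. Qed.

Lemma untouched_sub (prot prot' : pred nat) s s' :
  (forall X, prot X -> prot' X) -> untouched prot' s s' -> untouched prot s s'.
Proof. by move=> pp h X /pp; exact: h. Qed.

Lemma untouched_set (prot : pred nat) s s' X a v :
  ~~ prot X -> untouched prot s s' -> untouched prot s (set_cell s' X a v).
Proof.
move=> pX h Y pY b /=; have /negPf -> : Y != X by apply: contraTneq pY => ->.
exact: h.
Qed.

Lemma untouched_emit (prot : pred nat) s s' h o :
  untouched prot s s' -> untouched prot s (State (mem s') h o).
Proof. by []. Qed.

Lemma untouched_scalar (prot : pred nat) s s' X :
  untouched prot s s' -> prot X -> scalar s' X = scalar s X.
Proof. by move=> h pX; rewrite /scalar h. Qed.

Ltac norm := rewrite /scalar /= -?/(scalar _ _).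

Ltac clobber := repeat (apply: untouched_set; [by [] |]).

Section EmitArray.
Variables (O : oracle) (inp : store) (ONE I d T X x : nat).

Definition emit_array : prog := For ONE I d x (Seq (Get T X [:: I]) (Emit T)).

Lemma emit_array_ok (v : seq nat) s :
  uniq [:: ONE; I; d; T; X] -> scalar s ONE = 1 -> scalar s x = size v ->
  (forall i, i < size v -> mem s X [:: i] = nth 0 v i) ->
  wp O inp emit_array s (fun t s' =>
    [/\ t <= 5 * size v + 3, outp s' = outp s ++ v &
        untouched (off [:: I; d; T]) s s']).
Proof.
rewrite /= !inE !negb_or -!andbA => /and5P[oi od oT oX /and5P[iD iT iX dT]].
move=> /andP[dX /andP[TX _]] s1 sx sX.
apply: (@wp_for _ _ _ _ _ _ _ (fun k s' => outp s' = outp s ++ take k v /\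
   untouched (off [:: I; d; T]) s s') 2 (size v)) => //.
- by rewrite iD eq_sym oi eq_sym od.
- rewrite take0 cats0; split=> //.
  by do 2 ![apply: untouched_set; first by rewrite !inE eqxx ?orbT].
- move=> k s' kv [o u] si sd so; step; step; step.
  split=> //; rewrite /scalar /= ?(negPf iT) ?(negPf dT) ?(negPf oT) //=.
  split.
    rewrite o eqxx /= si u ?sX //.
      by rewrite (take_nth 0 kv) rcons_cat.
    by rewrite !inE !negb_or eq_sym iX eq_sym dX eq_sym TX.
  do 2 ![apply: untouched_set; first by rewrite !inE eqxx ?orbT].
  apply: untouched_emit.
  by do 1 ![apply: untouched_set; first by rewrite !inE eqxx ?orbT].
- move=> t s' tle [o u]; rewrite take_size in o; split=> //; lia.
Qed.

End EmitArray.

(** * From the hidden problem to the arity extension *)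

(* The arrays of the programs below are the multiples of 3, which keeps them apart
   from those of the two subroutines. *)
Definition nuA (X : nat) := (3 * X).+1.
Definition nuD (X : nat) := (3 * X).+2.

Lemma vals_nth w l (a : l.-tuple 'I_w) (i : 'I_l) : nth 0 (vals a) i = tnth a i.
Proof.
by rewrite /vals (nth_map (tnth a i)) ?size_tuple // -tnth_nth.
Qed.

Lemma size_vals w l (a : l.-tuple 'I_w) : size (vals a) = l.
Proof. by rewrite size_map size_tuple. Qed.

Lemma vals_inj w l : injective (@vals w l).
Proof. by move=> a b /(inj_map val_inj) e; apply: val_inj. Qed.

Lemma enc_params_sub v x inp : enc_params (rcons v x) inp -> enc_params v inp.
Proof.
by move=> h i iv; rewrite h ?nth_rcons ?iv // size_rcons (ltn_trans iv).
Qed.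

Section Oracles.
Variables (L : level) (m : nat) (C : instance L m).

(** An oracle without memory. As the hidden algorithm must succeed against every revealing oracle,
    it may be run against this one. *)
Definition answer_oracle (ans : assignment L -> option 'I_m) : oracle :=
  fun _ x =>
    if [pick a : assignment L | (a \in adm L) && (vals a == x)] is Some a
    then Some (enc_answer true false C (ans a)) else None.

Lemma answer_oracle_revealing ans :
  (forall a, a \in adm L -> truthful C a (ans a)) ->
  revealing_oracle true false C (answer_oracle ans).
Proof.
move=> tr h x; split=> [a aW ->|nx]; rewrite /answer_oracle; last first.
  by case: pickP => // a /andP[aW /eqP ea]; case: (nx a aW).
case: pickP => [a' /andP[a'W /eqP /vals_inj ->]|/(_ a)];
  last by rewrite aW eqxx.
by exists (ans a) => //; exact: tr.
Qed.

Definition first_violated (a : assignment L) : option 'I_m :=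
  [pick j | ~~ sat_constraint (C j) a].

Lemma first_violated_truthful a :
  a \in adm L -> truthful C a (first_violated a).
Proof.
rewrite /first_violated => aW; case: pickP => [j //|none]; split=> // j.
by have /negbFE := none j.
Qed.

End Oracles.

(** A step emits at most one number. So the time of an algorithm bounds the length of its output,
    and with it the cost of writing down a solution. *)
Lemma size_outp O inp p s t s' :
  exec O inp p s t s' -> size (outp s') <= size (outp s) + t.
Proof. by elim=> // *; rewrite /= ?size_rcons; lia. Qed.

(** * The simulation of a hidden algorithm on an instance of E(S) *)

Section ExtensionFromHidden.

Notation ONE := 0.
Notation DONE := 3.
Notation ZERO := 6.
Notation M := 9.
Notation BAD := 12.
Notation J := 15.
Notation dJ := 18.
Notation SZ := 21.
Notation OUTA := 24.
Notation CNTA := 27.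
Notation OUTD := 30.
Notation CNTD := 33.
Notation TWO := 36.
Notation R := 39.
Notation FND := 42.
Notation KK := 45.
Notation T1 := 48.
Notation I := 51.
Notation dI := 54.

Variables A D : prog.

(** Serves the membership test for constraint [J]: entry i of the tested tuple is the queried
    assignment at the i-th variable of the constraint, and the description of the relation is read
    off the instance itself. *)
Definition readD_B (X x f : nat) (ys : seq nat) : prog :=
  match f, ys with
  | 0, _ => Read x 0 ys
  | 1, [:: i] => Seq (Read T1 1 [:: J; i]) (Get x X [:: T1])
  | 1, _ => Const x 0
  | f, _ => Read x f (J :: ys)
  end.

Definition test_B (X : nat) : prog :=
  Seq (call nuD OUTD CNTD ONE DONE (readD_B X) (fun _ _ _ => Skip) D)
  (Seq (Get R OUTD [:: ZERO])
       (If R Skip (Op Add FND J ONE))).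

(** The scan leaves in [FND] the successor of the last violated index, or 0. The answer word is 0,
    j, k, and its first entry is already 0 after the reset. If nothing is violated, the query is
    output as a solution and [DONE] stops the simulation. *)
Definition query_B (Y X x : nat) : prog :=
  Seq (Const FND 0)
  (Seq (For ONE J dJ M (test_B X))
  (If FND
    (Seq (Op Sub FND FND ONE)
    (Seq (Read KK 2 [:: FND])
    (Seq (Reset Y) (Seq (Put Y [:: ONE] FND) (Put Y [:: TWO] KK)))))
    (Seq (Emit ONE) (Seq (emit_array ONE I dI T1 X x) (Const DONE 1))))).

(** Entry 5 of the parameters is m, after n, w, l, q, s. A constraint with an empty list leaves no
    tuple to choose, so this case is answered before the simulation starts. *)
Definition prog_B : prog :=
  Seq (Const ONE 1) (Seq (Const TWO 2) (Seq (Const T1 5)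
  (Seq (Read M 0 [:: T1])
  (Seq (For ONE J dJ M (Seq (Read SZ 3 [:: J; ZERO]) (If SZ Skip (Const BAD 1))))
  (If BAD (Emit ZERO)
    (Seq (call nuA OUTA CNTA ONE DONE (fun x f ys => Read x f ys) query_B A)
         (If DONE Skip (emit_array ONE I dI T1 OUTA CNTA)))))))).

(** The names congruent to 2 modulo 3 belong to the membership test. Those of the hidden algorithm
    are protected too, as its run is only suspended during the test. *)
Definition protD_B : pred nat :=
  [pred Z | (Z %% 3 != 2) && (Z \notin [:: T1; OUTD; CNTD])].

Lemma layoutD_B : layout nuD OUTD CNTD ONE DONE protD_B.
Proof.
split=> //.
- by move=> x y; rewrite /nuD; lia.
- by move=> x; rewrite /protD_B /nuD /= !inE; lia.
- by move=> x; rewrite /nuD; lia.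
- by move=> x; rewrite /nuD; lia.
Qed.

(** Only what must survive the whole simulation; the other variables of the caller are overwritten
    whenever a query is answered. *)
Definition protA_B : pred nat := mem_seq [:: ONE; DONE; ZERO; TWO; M].

Lemma layoutA_B : layout nuA OUTA CNTA ONE DONE protA_B.
Proof.
split=> //.
- by move=> x y; rewrite /nuA; lia.
- by move=> x; rewrite /protA_B /nuA /= ?inE; lia.
- by move=> x; rewrite /nuA; lia.
- by move=> x; rewrite /nuA; lia.
Qed.

Variables (S : csp) (n m : nat) (c : nat) (C : instance (ext_csp S n) m).
Variable inp : store.
Let l := len (S n).
Hypothesis encC : enc_instance (by_listing S) C inp.
Hypothesis D_ok : forall (k : 'I_(nrel (ext_csp S n)))
    (u : (arity (ext_csp S n)).-tuple 'I_(alph (ext_csp S n))) (inp : store),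
  enc_membership (by_listing S) k u inp ->
  runs_within no_oracle inp D c [:: (u \in rel k) : nat].

Definition inpD_B (s : state) (X j : nat) : store := fun f a =>
  match f, a with
  | 0, _ => inp 0 a
  | 1, [:: i] => mem s X [:: inp 1 [:: j; i]]
  | 1, _ => 0
  | f, _ => inp f (j :: a)
  end.

Lemma spareD_B z : z == T1 -> spare nuD OUTD CNTD protD_B z.
Proof. by move=> /eqP ->; split=> // X; rewrite /nuD; lia. Qed.

Lemma readD_B_ok V s0 X j s s' x f (ys : seq nat) :
  protD_B X -> scalar s0 J = j -> sim nuD OUTD CNTD V protD_B s0 s s' ->
  x \in V -> {subset ys <= V} ->
  wp no_oracle inp (readD_B X (nuD x) f (map nuD ys)) s' (fun t s1 =>
    t + 1 <= 4 /\ sim nuD OUTD CNTD V protD_B s0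
      (set_cell s x [::] (inpD_B s0 X j f (subscripts s ys))) s1).
Proof.
move=> pX sj h Vx Vy.
have sy := sim_subscripts h Vy.
have sJ : scalar s' J = j by rewrite -sj /scalar (sim_prot h).
have st := @sim_set _ _ _ _ _ V protD_B s0 layoutD_B.
case: f => [|[|f]] /=.
- by step; rewrite sy; split=> //; apply: st.
- case: ys Vy sy => [|i [|i' ys]] Vy sy /=; try by step; split=> //; apply: st.
  step; step; step; split=> //.
  set s1 := set_cell s' _ _ _; have h1 : sim nuD OUTD CNTD V protD_B s0 s s1.
    by apply: sim_spare => //; exact: spareD_B.
  have -> : mem s1 X (subscripts s1 [:: T1]) =
            mem s0 X [:: inp 1 [:: j; scalar s i]].
    rewrite (sim_prot h1) //; congr (mem _ _ [:: _]).
    by rewrite /scalar /= -sJ; case: sy => ->.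
  exact: st.
- by step; rewrite /= -/(subscripts _ _) sy sJ; split=> //; apply: st.
Qed.

Lemma test_B_ok s0 X (j : 'I_m) (a : assignment (S n)) :
  protD_B X -> scalar s0 J = j -> scalar s0 ONE = 1 -> scalar s0 DONE = 0 ->
  scalar s0 ZERO = 0 ->
  (forall i : 'I_l, mem s0 X [:: val i] = tnth a i) ->
  wp no_oracle inp (test_B X) s0 (fun t s' =>
    [/\ t <= 4 * c + size (names D) + 6,
        scalar s' FND = if sat_constraint (C j) a then scalar s0 FND else j.+1,
        untouched [pred Z | protD_B Z && (Z \notin [:: R; FND])] s0 s' &
        outp s' = outp s0]).
Proof.
move=> pX sj s1 sd sz sX; apply: wp_seq; apply: wp_mono.
  apply: (@subroutine_ok nuD OUTD CNTD ONE DONE (readD_B X) _ protD_B s0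
           no_oracle (inpD_B s0 X j) inp 4 D c
           [:: sat_constraint (C j) a : nat]) => //.
  - exact: layoutD_B.
  - by move=> s s' x f ys h Vx Vy; apply: readD_B_ok.
  apply: D_ok; have [e0 e1 e2] := encC; split; last exact: e2.
  - exact: enc_params_sub e0.
  - by move=> i /=; rewrite e1 sX tnth_mktuple.
move=> t s' [tle [_ b] un o].
have ez : scalar s' ZERO = 0 by rewrite (untouched_scalar un).
have r0 : mem s' OUTD (subscripts s' [:: ZERO]) = sat_constraint (C j) a.
  by rewrite /= ez b.
step; step; rewrite r0.
have un1 v : untouched [pred Z | protD_B Z && (Z \notin [:: R; FND])] s0
   (set_cell s' R [::] v).
  by apply: untouched_set => //; apply: untouched_sub un => Z /andP[].
apply: wp_if; rewrite [scalar _ _]/scalar /=; case: (sat_constraint _ _) => // _.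
  by step; split; [lia | exact: (untouched_scalar un) | exact: un1 | ].
step; split=> //; first by lia.
- rewrite /scalar /= -!/(scalar _ _) (untouched_scalar un (X := J)) //.
  by rewrite (untouched_scalar un (X := ONE)) // sj s1 addn1.
- by apply: untouched_set => //; exact: un1.
Qed.

Variables (k : 'I_m -> 'I_(nrel (S n)))
  (e : 'I_m -> seq (dtuple (len (S n)) (arity (S n)))).
Hypothesis Ck : forall j, ext_rel (C j).1 = rel_union (rel (k j)) [set t in e j].
Hypothesis inp_k : forall j : 'I_m, inp 2 [:: val j] = k j.
Hypothesis inp_e : forall j : 'I_m, inp 3 [:: val j; 0] = size (e j).

Definition violates (a : assignment (S n)) (j : nat) : bool :=
  if insub j is Some i then ~~ sat_constraint (C i) a else false.

Lemma violatesE a (j : 'I_m) : violates a j = ~~ sat_constraint (C j) a.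
Proof. by rewrite /violates valK. Qed.

(** If the scan finds nothing, the simulation has already stopped; the answer in that branch only
    has to keep the oracle truthful for the selected instance. *)
Definition answer (f : 'I_m -> dtuple (len (S n)) (arity (S n)))
    (a : assignment (S n)) : option 'I_m :=
  if blame (violates a) m is j.+1 then insub j
  else first_violated (selects C k f) a.

Definition oracle_for f : oracle := answer_oracle (selects C k f) (answer f).

Lemma oracle_for_revealing f : (forall j, f j \in e j) ->
  revealing_oracle true false (selects C k f) (oracle_for f).
Proof.
move=> fe; apply: answer_oracle_revealing => a aW; rewrite /answer.
case eb : (blame _ m) => [|j]; first exact: first_violated_truthful.
have [jm] := blameS eb; rewrite insubT /=.
by rewrite -[j]/(val (Ordinal jm)) violatesE; apply: ext_violated.
Qed.

Lemma scan_B_ok s0 X (a : assignment (S n)) :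
  let P := [pred Z | protD_B Z && (Z \notin [:: R; FND; J; dJ])] in
  P X -> scalar s0 ONE = 1 -> scalar s0 DONE = 0 ->
  scalar s0 ZERO = 0 -> scalar s0 M = m -> scalar s0 FND = 0 ->
  (forall i : 'I_l, mem s0 X [:: val i] = tnth a i) ->
  wp no_oracle inp (For ONE J dJ M (test_B X)) s0 (fun t s' =>
    [/\ t <= m * (4 * c + size (names D) + 9) + 3,
        scalar s' FND = blame (violates a) m,
        untouched P s0 s' & outp s' = outp s0]).
Proof.
move=> P PX s1 sd sz sm sf sX.
apply: (@wp_for _ _ _ _ _ _ _ (fun j s' =>
  [/\ scalar s' FND = blame (violates a) j, untouched P s0 s' &
     outp s' = outp s0]) (4 * c + size (names D) + 6) m) => //.
- by split=> //; do 2 ![apply: untouched_set => //].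
- move=> j s jm [f u o] sj sdj so.
  apply: wp_mono.
    apply: (@test_B_ok s X (Ordinal jm) a) => //.
    + by case/andP: PX.
    + by rewrite (untouched_scalar u).
    + by rewrite (untouched_scalar u).
    + by move=> i; rewrite u.
  move=> t s' [tle f' u' o'].
  split=> //; try by rewrite (untouched_scalar u').
  split; last by rewrite /= o'.
    rewrite /scalar /= -[LHS]/(scalar s' FND) f' f.
    by rewrite -[j]/(val (Ordinal jm)) violatesE; case: sat_constraint.
  do 2 ![apply: untouched_set => //].
  apply: (untouched_trans u); apply: untouched_sub u' => Z /andP[pZ].
  by rewrite !inE pZ; case: (Z == R) => //; case: (Z == FND).
- by move=> t s' tle [f u o]; split=> //; lia.
Qed.

Definition found (out : seq nat) : Prop :=
  exists2 a, satisfies C a & out = 1 :: vals a.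

Lemma spareA_B z : z \in [:: FND; KK] -> spare nuA OUTA CNTA protA_B z.
Proof. by rewrite !inE => /orP[] /eqP ->; split=> // X; rewrite /nuA; lia. Qed.

(** [K] is the price of a query, a scan of m membership tests. The extra [5 * l] is for writing down
    a solution, which happens at most once because it aborts the simulation. *)
Lemma query_B_ok V f s0 s s' Y X x ans :
  let K := m * (4 * c + size (names D) + 9) + 20 in
  scalar s0 ONE = 1 -> scalar s0 DONE = 0 -> scalar s0 TWO = 2 ->
  scalar s0 ZERO = 0 -> scalar s0 M = m -> outp s0 = [::] ->
  sim nuA OUTA CNTA V protA_B s0 s s' -> Y \in V -> X \in V -> x \in V ->
  oracle_for f (hist s) (query_word s X x) = Some ans ->
  wp no_oracle inp (query_B (nuA Y) (nuA X) (nuA x)) s'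
    (sim_post nuA OUTA CNTA DONE V protA_B s0 K (5 * l) found 1
      (set_array (State (mem s) (query_word s X x :: hist s) (outp s))
                 Y (array_of ans))).
Proof.
move=> K s1 sd s2 sz sm so h VY VX Vx.
rewrite /oracle_for /answer_oracle; case: pickP => // a /andP[aW /eqP aq] [<-].
have sx : scalar s x = l.
  by rewrite -[RHS](size_vals a) aq /query_word size_map size_iota.
have sX (i : 'I_l) : mem s X [:: val i] = tnth a i.
  by rewrite -vals_nth aq /query_word (nth_map 0) ?size_iota ?sx // nth_iota ?sx.
rewrite /query_B; step; step; step.
set sa := set_cell s' FND [::] 0.
have ha : sim nuA OUTA CNTA V protA_B s0 s sa.
  by apply: sim_spare h; exact: spareA_B.
have sc Z : protA_B Z -> scalar sa Z = scalar s0 Z.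
  by move=> pZ; rewrite (untouched_scalar (sim_prot ha)).
have PA Z : [pred Z | protD_B Z && (Z \notin [:: R; FND; J; dJ])] (nuA Z).
  by rewrite /protD_B /nuA /= !inE; lia.
apply: wp_mono.
  apply: (@scan_B_ok sa (nuA X) a) => //; try by rewrite sc.
  by move=> i; rewrite (sim_mem ha) ?sX.
move=> t sb [tle fb ub ob].
have hb : sim nuA OUTA CNTA V protA_B s0 s sb.
  apply: (sim_untouched ha ub) => // Z.
  exact: (allP (isT : all [pred Z | protD_B Z && (Z \notin [:: R; FND; J; dJ])]
                          [:: ONE; DONE; ZERO; TWO; M]) Z).
have sc' Z : protA_B Z -> scalar sb Z = scalar s0 Z.
  by move=> pZ; rewrite (untouched_scalar (sim_prot hb)).
apply: wp_if => fnz.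
  have [j ej] : exists j, blame (violates a) m = j.+1.
    by exists (blame (violates a) m).-1; rewrite prednK // lt0n -fb.
  have [jm vj] := blameS ej.
  step; step; step; step; step; step; step; step; step.
  set v1 := arith_val _ _ _.
  have v1j : v1 = j by rewrite /v1 /= fb ej sc' // s1 subn1.
  set v2 := inp 2 _.
  have v2j : v2 = k (Ordinal jm).
    by rewrite -inp_k /v2 /= /scalar /= v1j.
  set s3 := set_cell _ KK _ _.
  have h3 : sim nuA OUTA CNTA V protA_B s0 s s3.
    by do 2 ![apply: sim_spare; first exact: spareA_B].
  have nY Z : Z %% 3 == 0 -> (Z == nuA Y) = false by rewrite /nuA; lia.
  set s4 := set_array s3 _ _.
  have sc4 Z : Z %% 3 == 0 -> scalar s4 Z = scalar s3 Z.
    by move=> Z3; rewrite /scalar /= nY.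
  have -> : subscripts s4 [:: ONE] = [:: 1].
    by congr [:: _]; rewrite sc4 //; exact: etrans (sc' ONE isT) s1.
  have -> : scalar s4 FND = j by rewrite sc4 // -v1j.
  set s5 := set_cell s4 _ _ _.
  have sc5 Z : Z %% 3 == 0 -> scalar s5 Z = scalar s3 Z.
    by move=> Z3; rewrite /scalar /= nY // -[LHS]/(scalar s4 Z) sc4.
  have -> : subscripts s5 [:: TWO] = [:: 2].
    by congr [:: _]; rewrite sc5 //; exact: etrans (sc' TWO isT) s2.
  have -> : scalar s5 KK = k (Ordinal jm) by rewrite sc5 // -v2j.
  left; split; first by rewrite /K; lia.
  (* The answer was written cell by cell into a cleared array; it has the same cells as [array_of]
     of the answer word. *)
  apply: (sim_ext (s1 := set_cell (set_cell (set_array s Y (fun=> 0)) Y [:: 1] j)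
     Y [:: 2] (k (Ordinal jm)))) => //.
    do 2 ![apply: (sim_set layoutA_B)]; exact: (sim_array layoutA_B).
  move=> Z VZ b /=; rewrite /answer ej insubT /=.
  case: eqP => //= _; case: b => [|[|[|[|i]]] [|i' b]] //=.
  by rewrite nth_nil.
have eb : blame (violates a) m = 0 by rewrite -fb.
have satC : satisfies C a.
  split=> // j; have := blame0 eb (ltn_ord j).
  by rewrite violatesE negbK.
step; step; step.
set se := State _ _ _.
have he : {in V, forall Z b, mem se (nuA Z) b = mem s Z b}.
  by move=> Z VZ b; rewrite -(sim_mem hb).
apply: wp_mono.
  apply: (@emit_array_ok _ _ ONE I dI T1 (nuA X) (nuA x) (vals a) se).
  - by rewrite /= !inE /nuA; lia.
  - by rewrite -[LHS]/(scalar sb ONE) sc'.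
  - by rewrite -[LHS]/(scalar sb (nuA x)) (sim_scalar hb) // size_vals.
  - move=> i; rewrite size_vals => il; rewrite he //.
    by rewrite -[i]/(val (Ordinal il)) sX vals_nth.
move=> t' s3 [tle' o3 u3]; step; right; split=> //.
  by move: tle'; rewrite size_vals /K -/l; lia.
exists a => //; rewrite /= o3 /= (sim_outp hb) so.
by rewrite sc' // s1.
Qed.

Variable T : nat.
Hypothesis A_ok : forall (C' : instance (S n) m) O inp,
  revealing_oracle true false C' O ->
  enc_params (rcons (csp_params S n) m) inp ->
  exists2 out, runs_within O inp A T out & correct_output C' out.

(** If there is a solution, one of them determines [f]; otherwise any choice will do. The selection
    belongs to the analysis only: the program does not depend on it. *)
Lemma selection_exists : (forall j, e j != [::]) ->
  exists2 f, forall j, f j \in e j &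
    forall a, satisfies C a -> exists a', satisfies (selects C k f) a'.
Proof.
move=> e0.
case: (pickP (fun a : assignment (S n) =>
   (a \in adm (S n)) && [forall j, sat_constraint (C j) a])) => [a|none].
  case/andP=> aW /forallP aC; have [f fe fa] := sat_selects Ck (conj aW aC).
  by exists f => // _ _; exists a.
have /fin_all_exists[f fP] : forall j, exists t, t \in e j.
  by move=> j; case: (e j) (e0 j) => // t r _; exists t; rewrite mem_head.
exists f => // a [aW aC]; have := none a; rewrite aW.
by have -> : [forall j, sat_constraint (C j) a] by apply/forallP.
Qed.

Definition is_void (j : nat) : bool :=
  if insub j is Some i then e i == [::] else false.

Lemma prog_B_ok :
  wp no_oracle inp prog_B init_state (fun t s' =>
    t <= T * (m * (4 * c + size (names D) + 9) + 20) + 10 * T + m * 8 +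
         size (names A) + 30 /\ correct_output C (outp s')).
Proof.
have [e0 e1 e2] := encC.
rewrite /prog_B; do 8 step.
set s1 := set_cell _ M _ _.
have s1M : scalar s1 M = m.
  by rewrite /scalar /= e0 //= size_rcons.
step; apply: (@wp_for _ _ _ _ _ _ _ (fun j s' =>
  [/\ (scalar s' BAD == 0) = (blame is_void j == 0),
     untouched (off [:: J; dJ; SZ; BAD]) s1 s' & outp s' = [::]]) 4 m) => //.
- by split=> //; do 2 ![apply: untouched_set => //].
- move=> j s jm [sb u so] sj sdj s1'; step; step.
  have v : scalar (set_cell s SZ [::] (inp 3 (subscripts s [:: J; ZERO]))) SZ =
     size (e (Ordinal jm)).
    rewrite /scalar /= -inp_e /= sj; congr (inp 3 [:: _; _]).
    by rewrite (untouched_scalar u).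
  have vj : is_void j = (e (Ordinal jm) == [::]) by rewrite /is_void insubT.
  apply: wp_if; rewrite v => vs; step; split=> //; rewrite /= ?vj.
    split=> //.
      by rewrite -[LHS]/(scalar s BAD == 0) sb ifN // -size_eq0.
    by do 3 ![apply: untouched_set => //].
  split=> //; last by do 4 ![apply: untouched_set => //].
  by rewrite ifT // -size_eq0 vs.
move=> t s tle [sb u so]; apply: wp_if => bad.
  step; split; first by rewrite /=; lia.
  right; rewrite /= so (untouched_scalar u (X := ZERO)) //; split=> // a.
  case ej : (blame is_void m) => [|j]; first by rewrite sb ej in bad.
  have [jm] := blameS ej; rewrite /is_void insubT /= => /eqP ev.
  exact: (unsat_empty Ck ev).
have nonvoid j : e j != [::].
  have /blame0/(_ _ (ltn_ord j)) : blame is_void m = 0.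
    by apply/eqP; rewrite -sb bad.
  by rewrite /is_void valK.
have [f fe fC] := selection_exists nonvoid.
have [out [tA [sA [eA tAT <-]]] outP] := A_ok (oracle_for_revealing fe) e0.
have szA := size_outp eA; rewrite add0n in szA.
have u1 Z : Z \notin [:: J; dJ; SZ; BAD] -> scalar s Z = scalar s1 Z.
  by move=> nZ; rewrite (untouched_scalar u).
step; apply: wp_mono.
  apply: (@call_ok nuA OUTA CNTA ONE DONE (fun x f ys => Read x f ys) query_B
    (names A) protA_B s layoutA_B _ _ (oracle_for f) no_oracle inp inp
    (m * (4 * c + size (names D) + 9) + 20) (5 * l) found _ _ _ A tA sA) => //.
  - by rewrite u1.
  - by rewrite u1.
  - by lia.
  - move=> s2 s3 x g ys h Vx Vy; step; left; split; first by lia.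
    by rewrite (sim_subscripts h Vy); apply: sim_set h; exact: layoutA_B.
  - move=> s2 s3 Y X x ans h VY VX Vx oa.
    by apply: query_B_ok h VY VX Vx oa; rewrite ?u1.
move=> t1 s2 [[t1le h]|[t1le sd fd]]; apply: wp_if => sd'.
- by rewrite (sim_done layoutA_B _ h) ?u1 // in sd'.
- have [_ [bc b] _ o2] := h.
  apply: wp_mono.
    apply: (@emit_array_ok _ _ ONE I dI T1 OUTA CNTA (outp sA) s2) => //.
    by rewrite (untouched_scalar (sim_prot h)) // u1.
  move=> t2 s3 [t2le o3 _]; split.
    have : (m * (4 * c + size (names D) + 9) + 20) * tA <=
           T * (m * (4 * c + size (names D) + 9) + 20).
      by rewrite mulnC leq_mul2r tAT orbT.
    by lia.
  (* A solution of the selected instance solves [C]; if it has none, neither has [C], by the choice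
     of [f]. *)
  rewrite o3 o2 so /=; case: outP => [[a aC ->]|[na ->]].
    by left; exists a => //; exact: (selects_sat Ck fe).
  by right; split=> // a /fC[a' /na].
- step; split; last by left.
  (* The simulation stopped at a solution, so the selected instance is satisfiable and the
     uninterrupted run would have output l + 1 numbers. Hence [l < T], and the cost of writing down
     the solution is within [5 * T]. *)
  have [a aC _] := fd; have [a' a'C] := fC a aC.
  case: outP => [[a2 _ oA]|[/(_ a')]] //.
  have lT : l < T by apply: leq_trans tAT; rewrite oA /= size_vals in szA.
  have : (m * (4 * c + size (names D) + 9) + 20) * tA <=
           T * (m * (4 * c + size (names D) + 9) + 20).
      by rewrite mulnC leq_mul2r tAT orbT.
  by lia.
- by rewrite sd' in sd.
Qed.

End ExtensionFromHidden.

(** * Positivity of running times and the time bound of (b) *)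

Lemma runs_gt0 O inp p T out : runs_within O inp p T out -> 0 < T.
Proof. by move=> [t [s [ex tT _]]]; exact: leq_trans (exec_gt0 ex) tT. Qed.

(** The claimed bounds are products, so additive constants are absorbed only when all factors are
    positive. A run takes at least one step; here it is a run on some instance with some revealing
    oracle. *)
Lemma hidden_time_gt0 (S : csp) n m (T : nat) (A : prog) :
  (forall (C : instance (S n) m) O inp,
     revealing_oracle true false C O ->
     enc_params (rcons (csp_params S n) m) inp ->
     exists2 out, runs_within O inp A T out & correct_output C out) ->
  instance (S n) m -> 0 < T.
Proof.
move=> A_ok C.
have [|out r _] := A_ok C _ (fun _ => array_of (rcons (csp_params S n) m))
  (answer_oracle_revealing (@first_violated_truthful _ _ C)).
  by move=> i _.
exact: runs_gt0 r.
Qed.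

Lemma ext_comp_gt0 (S : csp) n m (C : instance (ext_csp S n) m) inp D c :
  0 < m -> enc_instance (by_listing S) C inp ->
  (forall (k : 'I_(nrel (ext_csp S n)))
     (u : (arity (ext_csp S n)).-tuple 'I_(alph (ext_csp S n))) (inp : store),
   enc_membership (by_listing S) k u inp ->
   runs_within no_oracle inp D c [:: (u \in rel k) : nat]) ->
  0 < c.
Proof.
move=> m0 [e0 _ e2] D_ok.
have [u _] := alph_inhab (S n) (len (S n)).
pose inp' : store := fun f a =>
  match f with 0 => inp 0 a | 1 => array_of (vals u) a | _ => inp f (0 :: a) end.
apply: (@runs_gt0 no_oracle inp' D); apply: (D_ok (C (Ordinal m0)).1 u); split.
- exact: enc_params_sub e0.
- by move=> i; rewrite /= vals_nth.
- exact: e2 (Ordinal m0).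
Qed.

Lemma hidden_to_extension (S : csp) (T : nat -> nat -> nat) (cE : nat -> nat) :
  hidden_solvable_in_time true false S T -> comp_within (by_listing S) cE ->
  exists c, solvable_in_time (by_listing S) (fun n m => c * (T n m * m * cE n)).
Proof.
(* The constant 81 is 4 + 9 + 20 + 10 + 8 + 30, the sum of the coefficients in the bound of
   [prog_B_ok] once each term is compared with T m c. *)
move=> [A A_ok] [D D_ok]; exists (size (names A) + size (names D) + 81).
exists (prog_B A D) => n m n0 m0 C inp encC.
have [e0 e1 e2] := encC.
have ke (j : 'I_m) :
    exists (k : 'I_(nrel (S n))) (e : seq (dtuple (len (S n)) (arity (S n)))),
    [/\ ext_rel (C j).1 = rel_union (rel k) [set t in e],
     inp 2 [:: val j] = k & inp 3 [:: val j; 0] = size e].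
  by have [k [e [Ck _ dk de _]]] := e2 j; exists k, e.
have /fin_all_exists[k kP] := ke; have /fin_all_exists[e keP] := kP.
have AT := A_ok n m n0 m0; have DT := D_ok n n0.
have T0 : 0 < T n m.
  apply: hidden_time_gt0 AT _ => j.
  exact: (k j, prefix_dtuple (arity_le (S n))).
have c0 := ext_comp_gt0 m0 encC DT.
have Ck j : ext_rel (C j).1 = rel_union (rel (k j)) [set t in e j].
  by case: (keP j).
have [||t [s [ex [tle sC]]]] := @prog_B_ok A D S n m _ C inp encC DT k e Ck _ _ _ AT.
- by move=> j; case: (keP j).
- by move=> j; case: (keP j).
exists (outp s) => //; exists t, s; split=> //; apply: leq_trans tle _.
move: (T n m) (cE n) T0 c0 (size (names A)) (size (names D)) => N c N0 c0 x y.
set z := N * m * c.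
have h1 : N * m <= z by rewrite leq_pmulr.
have h2 : N <= N * m by rewrite leq_pmulr.
have h3 : m <= N * m by rewrite leq_pmull.
have h4 : y * (N * m) <= y * z by rewrite leq_mul.
have h5 : x <= x * z by rewrite leq_pmulr // (leq_trans _ h1) // muln_gt0 N0.
have h6 : 0 < N * m by rewrite muln_gt0 N0.
have -> : N * (m * (4 * c + y + 9) + 20) = 4 * z + y * (N * m) + 9 * (N * m) + 20 * N.
  by rewrite /z; nia.
rewrite !mulnDl; lia.
Qed.

(** * Enumerating tuples of distinct indices *)

Section Arrangements.
Variable l : nat.

Definition extend (t : seq nat) : seq (seq nat) :=
  [seq rcons t v | v <- iota 0 l & v \notin t].

Fixpoint arrangements (p : nat) : seq (seq nat) :=
  if p is p'.+1 then flatten [seq extend t | t <- arrangements p']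
  else [:: [::]].

Lemma mem_arrangements p t :
  (t \in arrangements p) = [&& size t == p, uniq t & all (gtn l) t].
Proof.
elim: p t => [|p IH] t; first by rewrite inE; case: t.
apply/flattenP/idP => [[_ /mapP[u ut ->] /mapP[v]]|].
  rewrite mem_filter mem_iota /= add0n => /andP[vu vl] ->.
  move: ut; rewrite IH => /and3P[/eqP su uu ul].
  by rewrite size_rcons su eqxx rcons_uniq vu uu all_rcons ul /= vl.
case/lastP: t => [|u v]; first by [].
rewrite size_rcons eqSS rcons_uniq all_rcons => /and3P[su /andP[vu uu]].
case/andP=> vl ul; exists (extend u).
  by apply: map_f; rewrite IH su uu ul.
by apply: map_f; rewrite mem_filter vu mem_iota.
Qed.

Lemma arrangements_uniq p : uniq (arrangements p).
Proof.
elim: p => //= p IH; elim: (arrangements p) IH => //= t r IHr /andP[tr ur].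
rewrite cat_uniq IHr // andbT map_inj_in_uniq.
  rewrite filter_uniq ?iota_uniq //=; apply/hasPn => u /flattenP[_ /mapP[t' t'r ->]].
  case/mapP=> v _ ->; apply/mapP => -[v' _ /rcons_inj[e _]].
  by rewrite -e t'r in tr.
by move=> v v' _ _ /rcons_inj[].
Qed.

Lemma size_extend t : uniq t -> all (gtn l) t -> size (extend t) = l - size t.
Proof.
move=> ut tl; rewrite size_map size_filter.
have := count_predC [in t] (iota 0 l); rewrite size_iota.
have -> : count [in t] (iota 0 l) = size t.
  rewrite -size_filter; apply/perm_size/uniq_perm => //.
    by rewrite filter_uniq ?iota_uniq.
  move=> v; rewrite mem_filter mem_iota /=; case vt: (v \in t) => //=.
  by have /allP/(_ _ vt) := tl.
have -> : count (predC [in t]) (iota 0 l) =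
          count [pred v | v \notin t] (iota 0 l) by [].
by move=> h; rewrite -[in RHS]h addKn.
Qed.

Lemma size_arrangements p : size (arrangements p) = l ^_ p.
Proof.
elim: p => //= p IH; rewrite ffactnSr -IH size_flatten /shape -map_comp.
have : {in arrangements p, forall t, size (extend t) = l - p}.
  move=> t; rewrite mem_arrangements => /and3P[/eqP <- ut tl].
  exact: size_extend.
elim: (arrangements p) => //= t r IHr h.
rewrite h ?mem_head // IHr ?mulSn // => u ur.
by rewrite h // inE ur orbT.
Qed.

End Arrangements.

Lemma card_dtuple l q : #|{: dtuple l q}| = l ^_ q.
Proof.
rewrite -[in RHS](card_ord l) -card_uniq_tuples cardsE card_sub.
by apply: eq_card => t; rewrite !inE; apply/esym/andb_idl => _; apply/allP.
Qed.

Lemma ffact_le_mono l p q : p <= q -> q <= l -> l ^_ p <= l ^_ q.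
Proof.
elim: q => [|q IH]; first by rewrite leqn0 => /eqP->.
rewrite leq_eqVlt => /predU1P[->//|pq] ql; rewrite ffactnSr.
by apply: leq_trans (IH pq (ltnW ql)) _; rewrite leq_pmulr // subn_gt0.
Qed.

(** Listing the tuples takes about l q^2 steps per tuple; this makes it at most quadratic in their
    number. For q at least 3 it follows from l q^2 <= l^3 <= 9 l (l - 1) (l - 2). *)
Lemma ffact_ge_sq l q : q <= l -> l * q ^ 2 <= 9 * l ^_ q.
Proof.
case: q => [|[|[|q]]] ql; rewrite ?muln0 //.
- by rewrite ffactn1; lia.
- by rewrite ffactnS ffactn1; nia.
have h : l ^_ 3 <= l ^_ q.+3 by apply: ffact_le_mono.
apply: (@leq_trans (9 * l ^_ 3)); last by rewrite leq_mul2l h.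
apply: (@leq_trans (l * l ^ 2)); first by rewrite leq_mul2l leq_sqr ql orbT.
rewrite !ffactnS ffactn0; have : 3 <= l by apply: leq_trans ql.
case: l {ql h} => [|[|[|l]]] // _; rewrite /= !expnS !expn0; nia.
Qed.

(** * A program that lists the tuples, stage by stage in their length *)

Section Enumeration.

Notation ONE := 0.
Notation L := 9.
Notation Q := 12.
Notation NN := 18.
Notation G := 21.
Notation NUM := 24.
Notation P := 27.
Notation dP := 30.
Notation P1 := 33.
Notation NP := 36.
Notation R := 39.
Notation dR := 42.
Notation V := 45.
Notation dV := 48.
Notation I := 51.
Notation dI := 54.
Notation X := 57.
Notation B := 60.
Notation B2 := 63.
Notation BAD := 66.
Notation CT := 69.
Notation ZERO := 6.

(** There is no equality test: [X <= V] + [V <= X] - 1 is 1 if X = V and 0 otherwise. [BAD] adds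
    these up, so it stays 0 exactly when [V] does not occur in the row. *)
Definition copy_row : prog :=
  For ONE I dI P
    (Seq (Get X G [:: P; R; I]) (Seq (Put G [:: P1; CT; I] X)
    (Seq (Op Leq B X V) (Seq (Op Leq B2 V X) (Seq (Op Add B B B2)
    (Seq (Op Sub B B ONE) (Op Add BAD BAD B))))))).

(** Every candidate is written to row [CT], but [CT] advances only if the new entry is fresh; a
    rejected row is overwritten by the next candidate. *)
Definition extend_row : prog :=
  For ONE V dV L
    (Seq (Const BAD 0) (Seq copy_row
    (Seq (Put G [:: P1; CT; P] V) (If BAD Skip (Op Add CT CT ONE))))).

Definition enumerate : prog :=
  Seq (Put NUM [:: ZERO] ONE)
  (Seq (For ONE P dP Q
    (Seq (Op Add P1 P ONE) (Seq (Get NP NUM [:: P]) (Seq (Const CT 0)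
    (Seq (For ONE R dR NP extend_row) (Put NUM [:: P1] CT))))))
  (Get NN NUM [:: Q])).

Variables (O : oracle) (inp : store).

Definition stores (s : state) (p : nat) (ts : seq (seq nat)) : Prop :=
  forall r i, r < size ts -> i < p ->
    mem s G [:: p; r; i] = nth 0 (nth [::] ts r) i.

Lemma copy_row_ok s0 p c r v (t : seq nat) : size t = p ->
  scalar s0 ONE = 1 -> scalar s0 P = p -> scalar s0 P1 = p.+1 ->
  scalar s0 R = r -> scalar s0 V = v -> scalar s0 CT = c -> scalar s0 BAD = 0 ->
  (forall i, i < p -> mem s0 G [:: p; r; i] = nth 0 t i) ->
  wp O inp copy_row s0 (fun k s =>
    [/\ k <= 10 * p + 3, (scalar s BAD == 0) = (v \notin t),
        forall i, i < p -> mem s G [:: p.+1; c; i] = nth 0 t i,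
        forall a, take 2 a != [:: p.+1; c] -> mem s G a = mem s0 G a &
        untouched (off [:: G; I; dI; X; B; B2; BAD]) s0 s /\ outp s = outp s0]).
Proof.
move=> st s1 sp sp1 sr sv sc sb sg.
apply: (@wp_for _ _ _ _ _ _ _ (fun k s =>
  [/\ (scalar s BAD == 0) = (v \notin take k t),
      forall i, i < k -> mem s G [:: p.+1; c; i] = nth 0 t i,
      forall a, take 2 a != [:: p.+1; c] -> mem s G a = mem s0 G a &
      untouched (off [:: G; I; dI; X; B; B2; BAD]) s0 s /\ outp s = outp s0])
  7 p) => //.
- split=> //.
    by rewrite /scalar /= -[mem s0 _ _]/(scalar s0 _) sb take0.
  by split=> //; do 2 ![apply: untouched_set => //].
- move=> k s kp [b g ga [u o]] si sdi s1'.
  have e Z : Z \notin [:: G; I; dI; X; B; B2; BAD] -> scalar s Z = scalar s0 Z.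
    by move=> h; rewrite (untouched_scalar u).
  have [[[[eP eR] eP1] eCT] eV] := (e P isT, e R isT, e P1 isT, e CT isT, e V isT).
  have xk : mem s G [:: p; r; k] = nth 0 t k.
    by rewrite ga ?sg //; apply/eqP => -[]; lia.
  step; step; norm; rewrite eP eR si sp sr xk.
  step; step; norm; rewrite eP1 sp1 eCT sc si.
  step; step; norm; rewrite eV sv.
  step; step; norm; rewrite eV sv.
  step; step; norm.
  step; step; norm; rewrite s1'.
  step; norm.
  split=> //; split.
  + rewrite addn_eq0 b (take_nth 0) ?st // mem_rcons inE negb_or andbC.
    by congr (_ && _); case: ltngtP.
  + move=> i; rewrite ltnS leq_eqVlt => /predU1P[->|ik]; first by rewrite eqxx.
    by case: eqP => [[->]|_] //; exact: g.
  + by move=> a ha; case: eqP => [ea|_]; [rewrite ea eqxx in ha | exact: ga].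
  + by split=> //; clobber.
- move=> k s kp [b g ga uo]; split=> //; first by lia.
  by rewrite -st take_size in b.
Qed.

Lemma extend_row_ok l s0 p r (t : seq nat) acc : size t = p ->
  scalar s0 ONE = 1 -> scalar s0 P = p -> scalar s0 P1 = p.+1 ->
  scalar s0 R = r -> scalar s0 L = l -> scalar s0 CT = size acc ->
  (forall i, i < p -> mem s0 G [:: p; r; i] = nth 0 t i) ->
  stores s0 p.+1 acc ->
  wp O inp extend_row s0 (fun k s =>
    [/\ k <= l * (10 * p + 10) + 3, scalar s CT = size (acc ++ extend l t),
        stores s p.+1 (acc ++ extend l t),
        forall a, head 0 a != p.+1 -> mem s G a = mem s0 G a &
        untouched (off [:: G; I; dI; X; B; B2; BAD; CT; V; dV]) s0 s /\
        outp s = outp s0]).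
Proof.
move=> st s1 sp sp1 sr sl sc sg sG.
pose ext k := acc ++ [seq rcons t v | v <- iota 0 k & v \notin t].
apply: (@wp_for _ _ _ _ _ _ _ (fun k s =>
    [/\ scalar s CT = size (ext k), stores s p.+1 (ext k),
        forall a, head 0 a != p.+1 -> mem s G a = mem s0 G a &
        untouched (off [:: G; I; dI; X; B; B2; BAD; CT; V; dV]) s0 s /\
        outp s = outp s0]) (10 * p + 7) l) => //.
- rewrite /ext /= cats0; split=> //.
  by split=> //; clobber.
- move=> k s kl [ct st' ga [u o]] sv sdv s1'.
  have e Z : Z \notin [:: G; I; dI; X; B; B2; BAD; CT; V; dV] ->
    scalar s Z = scalar s0 Z by move=> h; rewrite (untouched_scalar u).
  step; step; step; apply: wp_mono.
    apply: (@copy_row_ok _ p (size (ext k)) r k t) => //=; norm;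
      rewrite ?(e P) ?(e P1) ?(e R) //.
    by move=> i ip; rewrite ga ?sg //=; lia.
  move=> x s2 [xle b g2 ga2 [u2 o2]].
  have e2 Z : Z \notin [:: G; I; dI; X; B; B2; BAD] -> scalar s2 Z = scalar s Z.
    move=> h; rewrite (untouched_scalar u2) //; norm.
    by have /negPf -> : Z != BAD by move: h; rewrite !inE; lia.
  step; step; norm.
  rewrite (e2 P1) // (e P1) // (e2 CT) // (e2 P) // (e P) // (e2 V) // sp sp1 sv ct.
  set s3 := set_cell _ _ _ _.
  have g3 : stores s3 p.+1 (rcons (ext k) (rcons t k)).
    move=> r' i; rewrite size_rcons ltnS leq_eqVlt nth_rcons /s3 /= !eqseq_cons.
    rewrite !eqxx /= !andbT => /predU1P[->|rk] ip.
      rewrite eqxx ltnn nth_rcons st /=.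
      move: ip; rewrite ltnS leq_eqVlt => /predU1P[->|ip].
        by rewrite eqxx ltnn.
      by rewrite (ltn_eqF ip) ip; exact: g2.
    by rewrite rk (ltn_eqF rk) /= ga2 /= ?st' // !eqseq_cons (ltn_eqF rk) andbF.
  have ga3 a : head 0 a != p.+1 -> mem s3 G a = mem s0 G a.
    move=> ha; rewrite /s3 /=; case: eqP => [ea|_]; first by rewrite ea eqxx in ha.
    rewrite ga2 /= ?ga //; case: (a) ha => [|? [|? ?]] //=.
      by rewrite !eqseq_cons => /negPf ->.
    by rewrite !eqseq_cons => /negPf ->.
  have u3 : untouched (off [:: G; I; dI; X; B; B2; BAD; CT; V; dV]) s0 s3.
    apply: untouched_set => //; apply: (untouched_trans u).
    apply: (@untouched_trans _ _ (set_cell s BAD [::] 0)); first by clobber.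
    by apply: untouched_sub u2 => Z; rewrite /= !inE; lia.
  have eS : ext k.+1 = ext k ++ (if k \notin t then [:: rcons t k] else [::]).
    rewrite /ext -addn1 iotaD filter_cat map_cat catA add0n /=.
    by case: (k \in t).
  apply: wp_if; rewrite -[scalar s3 BAD]/(scalar s2 BAD) => bad.
    step; split=> //; norm.
    + by lia.
    + by rewrite (e2 V).
    + by rewrite (e2 dV).
    + by rewrite (e2 ONE).
    rewrite eS -b ifN // cats0; split=> //.
    + by norm; rewrite (e2 CT).
    + move=> r' i rk ip; rewrite -[LHS]/(mem s3 G _) g3 ?nth_rcons ?rk //.
      by rewrite size_rcons ltnW.
    by split; [do 2 ![apply: untouched_set => //] | rewrite o2 /= o].
  step; norm; rewrite (e2 CT) // ct (e2 ONE) // s1'; split=> //; norm.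
  + by lia.
  + by rewrite (e2 V).
  + by rewrite (e2 dV).
  rewrite eS -b bad eqxx cats1 size_rcons addn1; split=> //.
  by split; [do 3 ![apply: untouched_set => //] | rewrite /= o2 /= o].
by move=> k s kl [ct sG' ga uo]; split=> //; lia.
Qed.

Definition enum_names : seq nat :=
  [:: G; NUM; P; dP; P1; NP; R; dR; V; dV; I; dI; X; B; B2; BAD; CT; NN].

Lemma enumerate_ok l q s0 : q <= l ->
  scalar s0 ONE = 1 -> scalar s0 ZERO = 0 -> scalar s0 L = l ->
  scalar s0 Q = q ->
  wp O inp enumerate s0 (fun t s =>
    [/\ t <= 330 * (l ^_ q * l ^_ q), scalar s NN = l ^_ q,
        stores s q (arrangements l q),
        untouched (off enum_names) s0 s & outp s = outp s0]).
Proof.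
move=> ql s1 sz sl sq; rewrite /enumerate; step; step; norm; rewrite sz s1.
step; apply: (@wp_for _ _ _ _ _ _ _ (fun p s =>
    [/\ stores s p (arrangements l p), mem s NUM [:: p] = l ^_ p,
       untouched (off enum_names) s0 s & outp s = outp s0])
  (l ^_ q * (l * (10 * q + 10) + 6) + 7) q) => //.
- by split=> //; last by clobber.
- move=> p s pq [g num u o] sp sdp s1'.
  have e Z : Z \notin enum_names -> scalar s Z = scalar s0 Z.
    by move=> h; rewrite (untouched_scalar u).
  step; step; norm; rewrite sp s1' addn1.
  step; step; norm; rewrite sp num.
  step; step; step; set s2 := set_cell _ CT _ _.
  have u2 : untouched (off enum_names) s0 s2.
    by do 3 ![apply: untouched_set => //].
  pose acc k := flatten [seq extend l t | t <- take k (arrangements l p)].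
  apply: (@wp_for _ _ _ _ _ _ _ (fun k s' =>
    [/\ scalar s' CT = size (acc k), stores s' p.+1 (acc k),
        forall a, head 0 a != p.+1 -> mem s' G a = mem s G a &
        untouched (off [:: G; I; dI; X; B; B2; BAD; CT; V; dV; R; dR]) s2 s' /\
        outp s' = outp s2]) (l * (10 * p + 10) + 3) (l ^_ p)) => //.
  + by split=> //; [rewrite /acc take0 | rewrite /acc take0 |
                    split=> //; do 2 ![apply: untouched_set => //]].
  + move=> k s' kN [ct st ga [u' o']] sr sdr s1''.
    have kS : k < size (arrangements l p) by rewrite size_arrangements.
    have e' Z : Z \notin [:: G; I; dI; X; B; B2; BAD; CT; V; dV; R; dR] ->
        scalar s' Z = scalar s2 Z.
      by move=> h; rewrite (untouched_scalar u').
    have tk := mem_nth [::] kS; rewrite mem_arrangements in tk.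
    case/and3P: tk => /eqP tk _ _.
    apply: wp_mono.
      apply: (@extend_row_ok l s' p k _ (acc k) tk) => //; rewrite ?(e' P) ?(e' P1) ?(e' L) //.
      * by norm; rewrite e.
      * by move=> i ip; rewrite ga ?g //=; lia.
    move=> t s3 [tle ct3 st3 ga3 [u3 o3]].
    have eS : acc k.+1 = acc k ++ extend l (nth [::] (arrangements l p) k).
      by rewrite /acc (take_nth [::] kS) map_rcons flatten_rcons.
    split=> //; try by rewrite (untouched_scalar u3).
    split; rewrite ?eS //.
    * by move=> a ha; rewrite /= ga3 ?ga.
    * split; last by rewrite /= o3 o'.
      do 2 ![apply: untouched_set => //]; apply: (untouched_trans u').
      by apply: untouched_sub u3 => Z; rewrite /= !inE; lia.
  move=> t s3 tle [ct st ga [u3 o3]].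
  have e3 Z : Z \notin [:: G; I; dI; X; B; B2; BAD; CT; V; dV; R; dR] ->
        scalar s3 Z = scalar s2 Z.
    by move=> h; rewrite (untouched_scalar u3).
  have aE : acc (l ^_ p) = arrangements l p.+1.
    by rewrite /acc -size_arrangements take_size.
  step; norm; rewrite (e3 P1) // ct aE size_arrangements.
  split; rewrite ?(e3 P) ?(e3 dP) ?(e3 ONE) //; norm.
  (* Shorter tuples are not more numerous than those of the last stage, so one bound serves for all
     stages. *)
  + have h1 : l ^_ p <= l ^_ q by apply: ffact_le_mono => //; exact: ltnW.
    have h2 : l ^_ p * (l * (10 * p + 10) + 6) <=
              l ^_ q * (l * (10 * q + 10) + 6).
      apply: leq_mul => //; rewrite leq_add2r leq_mul2l leq_add2r leq_mul2l /=.
      by rewrite ltnW // orbT.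
    by lia.
  + split; last by rewrite /= o3 /= o.
    * by move=> r i rk ip; rewrite /= st ?aE.
    * by rewrite /= eqxx.
    * do 3 ![apply: untouched_set => //]; apply: (untouched_trans u2).
      by apply: untouched_sub u3 => Z; rewrite /enum_names /= !inE; lia.
move=> t s tle [g num u o]; step; norm.
rewrite (untouched_scalar u (X := Q)) // sq num; split=> //.
- have h := ffact_ge_sq ql.
  have h0 : 0 < l ^_ q by rewrite ffact_gt0.
  have h1 : q <= l * q ^ 2 by case: (q) ql => // q' ql'; nia.
  (* 26 is 10 + 10 + 6, and 234 below is 9 times 26. With [10 * q] at most 90 N and a few single
     steps the total stays below 330 N^2. *)
  have h2 : q * (l * (10 * q + 10) + 6) <= 26 * (l * q ^ 2).
    by rewrite !expnS expn0 muln1; case: (q) ql => // q' ql'; nia.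
  have h3 : q * (l * (10 * q + 10) + 6) <= 234 * l ^_ q by lia.
  have h4 : l ^_ q * (q * (l * (10 * q + 10) + 6)) <= l ^_ q * (234 * l ^_ q).
    by rewrite leq_mul2l h3 orbT.
  have h5 : l ^_ q <= l ^_ q * l ^_ q by rewrite leq_pmulr.
  have h6 : q <= 9 * l ^_ q by lia.
  by move: tle h4; set z := l ^_ q in h h0 h3 h5 h6 *; nia.
- by apply: untouched_set.
Qed.

End Enumeration.

(** * From the arity extension to the hidden problem *)

Section ExtensionConstraints.
Variable L : level.

Lemma rel_union_ext (k : 'I_(nrel L)) (U : {set dtuple (len L) (arity L)}) :
  rel_union (rel k) U \in ext_rel_set L.
Proof.
by apply/bigcupP; exists (rel k); [exact: imset_f | exact: imset_f].
Qed.

(** The variables are taken in their natural order. The rank of the relation in the type of E(S) is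
    never computed: a machine sees the relation only through a listing. *)
Definition ext_constraint k U : constraint (ext_level L) :=
  (enum_rank_in (rel_union_ext k U) (rel_union (rel k) U), id_dtuple (len L)).

Lemma ext_constraintE k U : ext_rel (ext_constraint k U).1 = rel_union (rel k) U.
Proof. by rewrite /ext_rel enum_rankK_in // rel_union_ext. Qed.

Lemma sat_ext_constraint k U (a : assignment L) :
  sat_constraint (ext_constraint k U) a = (a \in rel_union (rel k) U).
Proof. by rewrite /sat_constraint /= ext_constraintE project_id. Qed.

(** A member of the relation extends to an admissible assignment, because the relation is contained
    in W_q; the tuple of the first q indices then puts that assignment into the union over all
    tuples. *)
Lemma rel_empty k (e : seq (dtuple (len L) (arity L))) :
  (forall t, t \in e) ->
  (forall a, a \notin rel_union (rel k) [set t in e]) -> rel k = set0.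
Proof.
move=> full none; apply/setP => u; rewrite inE; apply/negP => uk.
have := subsetP (rel_adm k) _ uk; rewrite inE => /existsP[a /andP[aW /eqP au]].
have le := arity_le L; pose t := prefix_dtuple le.
have /negP := none a; apply; apply/rel_unionP; split=> //; exists t => //.
suff -> : project a t = u by [].
apply: eq_from_tnth => i; rewrite !tnth_mktuple.
rewrite (tnth_nth (tnth u i)) /= (tnth_nth (tnth u i)) -[in RHS]au nth_take //.
by apply: set_nth_default; rewrite size_tuple (leq_trans (ltn_ord i)).
Qed.

End ExtensionConstraints.

(** * Numbering the tuples of distinct indices *)

Section IndexedTuples.
Variables l q : nat.
Hypothesis ql : q <= l.

Definition indices_of (t : dtuple l q) : seq nat := map val (val (val t)).

Lemma indices_of_inj : injective indices_of.
Proof. by move=> t u /(inj_map val_inj) e; do 2 apply: val_inj. Qed.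

Lemma indices_ofP s :
  reflect (exists t, indices_of t = s) (s \in arrangements l q).
Proof.
rewrite mem_arrangements; apply: (iffP and3P) => [[/eqP ss us sl]|[t <-]].
  have sz : size (pmap insub s : seq 'I_l) == q.
    by rewrite size_pmap_sub -ss -all_count.
  have vs : map val (pmap insub s : seq 'I_l) = s.
    rewrite pmap_filter; last by move=> x; exact: insubK.
    rewrite (eq_filter (a2 := gtn l)) ?(all_filterP sl) // => x.
    by rewrite /= isSome_insub.
  have ut : uniq (Tuple sz) by rewrite -(map_inj_uniq val_inj) vs.
  by exists (exist (fun u : q.-tuple 'I_l => uniq u) _ ut).
rewrite size_map size_tuple eqxx (map_inj_uniq val_inj) (valP t); split=> //.
by apply/allP => _ /mapP[i _ ->] /=; exact: ltn_ord.
Qed.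

(** The default is taken only for [r] beyond the number of tuples; below it [tuple_at] is a
    bijection onto all tuples. *)
Definition tuple_at (r : nat) : dtuple l q :=
  odflt (prefix_dtuple ql)
    [pick t | indices_of t == nth [::] (arrangements l q) r].

Lemma tuple_atE r : r < l ^_ q ->
  indices_of (tuple_at r) = nth [::] (arrangements l q) r.
Proof.
rewrite -size_arrangements => /(mem_nth [::]) /indices_ofP[t et].
by rewrite /tuple_at; case: pickP => [u /eqP|/(_ t)]; rewrite ?et ?eqxx.
Qed.

Lemma tuple_at_inj : {in gtn (l ^_ q) &, injective tuple_at}.
Proof.
move=> i j il jl /(congr1 indices_of); rewrite !tuple_atE // => /eqP.
by rewrite nth_uniq ?size_arrangements ?arrangements_uniq // => /eqP.
Qed.

Lemma tuple_at_onto t : exists2 r, r < l ^_ q & tuple_at r = t.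
Proof.
have at_ : indices_of t \in arrangements l q by apply/indices_ofP; exists t.
exists (index (indices_of t) (arrangements l q)).
  by rewrite -size_arrangements index_mem.
apply: indices_of_inj; rewrite tuple_atE ?nth_index //.
by rewrite -size_arrangements index_mem.
Qed.

End IndexedTuples.

(** * The simulation of an algorithm for E(S) against a hidden instance *)

Section HiddenFromExtension.

Notation ONE := 0.
Notation DONE := 3.
Notation ZERO := 6.
Notation L := 9.
Notation Q := 12.
Notation SN := 15.
Notation NN := 18.
Notation G := 21.
Notation R := 39.
Notation dR := 42.
Notation I := 51.
Notation dI := 54.
Notation X := 57.
Notation TWO := 72.
Notation GO := 75.
Notation OUT := 78.
Notation CNT := 81.
Notation QA := 84.
Notation Y := 87.
Notation JJ := 90.
Notation KC := 93.
Notation SL := 96.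
Notation REP := 99.
Notation KA := 102.
Notation DEF := 105.
Notation RM := 108.
Notation ET := 111.
Notation LEN := 114.
Notation W := 117.
Notation CUR := 120.
Notation RES := 123.
Notation I1 := 126.
Notation T1 := 129.
Notation T2 := 132.
Notation Z1 := 135.
Notation RV := 138.

Variables A D : prog.

Definition find_slot (j : nat) : prog :=
  Seq (Get T1 REP [:: j]) (If T1 Skip (Get T1 DEF [::])).

Definition find_entry (z r out : nat) : prog :=
  Seq (Get out ET [:: z; r])
      (If out (Op Sub out out ONE) (Get out r [::])).

(** Computes the presented instance on demand: field 1 is the identity arrangement; fields 2, 3 and
    4 give the relation index, the length of the list and its tuples, all taken from the slot of the
    constraint. *)
Definition readA (x f : nat) (ys : seq nat) : prog :=
  match f, ys with
  | 0, _ => Read x 0 ys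
  | 1, [:: _; i] => Get x i [::]
  | 2, [:: j] => Seq (find_slot j) (Get x KA [:: T1])
  | 3, [:: j; _] =>
      Seq (find_slot j) (Seq (Get T2 RM [:: T1]) (Op Sub x NN T2))
  | 4, [:: j; r; i] =>
      Seq (find_slot j) (Seq (find_entry T1 r T2) (Get x G [:: Q; T2; i]))
  | _, _ => Const x 0
  end.

Definition readD (x f : nat) (ys : seq nat) : prog :=
  match f, ys with
  | 0, _ => Read x 0 ys
  | 1, [:: i] => Seq (Get T1 G [:: Q; CUR; i]) (Get x QA [:: T1])
  | 2, [::] => Get x KC [::]
  | _, _ => Const x 0
  end.

Definition callA : prog :=
  call nuA OUT CNT ONE DONE readA (fun _ _ _ => Skip) A.

Definition callD : prog :=
  call nuD OUT CNT ONE DONE readD (fun _ _ _ => Skip) D.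

(** A tuple at which the queried assignment belongs to the relation cannot be that of the violated
    constraint. The other tuples are written back in place, as successors of their indices. *)
Definition prune_step : prog :=
  Seq (find_entry SL R CUR) (Seq callD (Seq (Get RES OUT [:: ZERO])
    (If RES Skip
      (Seq (Op Add Z1 CUR ONE) (Seq (Put ET [:: SL; W] Z1) (Op Add W W ONE)))))).

Definition prune : prog :=
  Seq (Get RV RM [:: SL]) (Seq (Op Sub LEN NN RV) (Seq (Const W 0)
  (Seq (For ONE R dR LEN prune_step)
  (Seq (Op Sub RV NN W) (Put RM [:: SL] RV))))).

(** Entry i of the solution is cell i + 1 of the output, after the leading 1. The slot just filled
    becomes the default for constraints not yet revealed. *)
Definition ask : prog :=
  Seq (For ONE I dI L (Seq (Op Add I1 I ONE) (Seq (Get X OUT [:: I1]) (Put QA [:: I] X))))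
  (Seq (Query Y QA L) (Seq (Get X Y [:: ZERO])
  (If X (Const GO 0)
    (Seq (Get JJ Y [:: ONE]) (Seq (Get KC Y [:: TWO]) (Seq (Op Add SL JJ ONE)
    (Seq (Put REP [:: JJ] SL) (Seq (Put KA [:: SL] KC) (Seq (Get DEF SL [::])
      prune))))))))).

Definition no_solution : prog :=
  If DEF (Const GO 0)
    (Seq (Get X KA [:: ZERO])
    (If X (Const GO 0)
      (Seq (Op Leq X TWO SN) (If X (Put KA [:: ZERO] ONE) (Const GO 0))))).

Definition iteration : prog :=
  Seq callA (Seq (Get X OUT [:: ZERO]) (If X ask no_solution)).

(** Entries 2, 3 and 4 of the parameters are l, q and s. When the loop ends, the last output of the
    subroutine is itself the correct output, both for a solution and for a negative answer. *)
Definition prog_A : prog :=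
  Seq (Const ONE 1) (Seq (Const TWO 2)
  (Seq (Read L 0 [:: TWO])
  (Seq (Const X 3) (Seq (Read Q 0 [:: X]) (Seq (Const X 4) (Seq (Read SN 0 [:: X])
  (Seq enumerate (Seq (Const GO 1) (Seq (While GO iteration)
    (emit_array ONE I dI T1 OUT CNT)))))))))).

(** The calls of the two subroutines are not nested and each clears its own names, so only names of
    the caller are protected. *)
Definition prot_sub : pred nat :=
  [pred Z | (Z %% 3 == 0) && (Z \notin [:: T1; T2; OUT; CNT])].

Lemma layout_callA : layout nuA OUT CNT ONE DONE prot_sub.
Proof.
split=> //.
- by move=> x y; rewrite /nuA; lia.
- by move=> x; rewrite /prot_sub /nuA /= !inE; lia.
- by move=> x; rewrite /nuA; lia.
- by move=> x; rewrite /nuA; lia.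
Qed.

Lemma layout_callD : layout nuD OUT CNT ONE DONE prot_sub.
Proof.
split=> //.
- by move=> x y; rewrite /nuD; lia.
- by move=> x; rewrite /prot_sub /nuD /= !inE; lia.
- by move=> x; rewrite /nuD; lia.
- by move=> x; rewrite /nuD; lia.
Qed.

Variables (S : csp) (n m T c : nat) (C : instance (S n) m).
Variables (O : oracle) (inp : store).

Let l := len (S n).
Let q := arity (S n).
Let N := l ^_ q.
Let at_ := tuple_at (arity_le (S n)).

Hypothesis O_ok : revealing_oracle true false C O.
Hypothesis enc : enc_params (rcons (csp_params S n) m) inp.
Hypothesis A_ok : forall (C' : instance (ext_csp S n) m) (inp : store),
  enc_instance (by_listing S) C' inp ->
  exists2 out, runs_within no_oracle inp A T out & correct_output C' out.
Hypothesis D_ok : forall (k : 'I_(nrel (S n)))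
    (u : (arity (S n)).-tuple 'I_(alph (S n))) (inp : store),
  enc_membership (by_index S) k u inp ->
  runs_within no_oracle inp D c [:: (u \in rel k) : nat].

Record env (s : state) : Prop := Env {
  env_one : scalar s ONE = 1;
  env_two : scalar s TWO = 2;
  env_zero : scalar s ZERO = 0;
  env_done : scalar s DONE = 0;
  env_len : scalar s L = l;
  env_arity : scalar s Q = q;
  env_nrel : scalar s SN = nrel (S n);
  env_number : scalar s NN = N;
  env_tuples : stores s q (arrangements l q);
  env_outp : outp s = [::]
}.

Definition env_names : seq nat := [:: ONE; TWO; ZERO; DONE; L; Q; SN; NN; G].

Lemma env_untouched (P : pred nat) s s' :
  env s -> untouched P s s' -> all P env_names -> outp s' = outp s -> env s'.
Proof.
move=> h u /allP Pe o; have e Z : Z \in env_names -> scalar s' Z = scalar s Z.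
  by move=> /Pe PZ; rewrite (untouched_scalar u).
case: h => *; split; rewrite ?o // ?e //.
by move=> r i rk iq; rewrite (u _ (Pe G isT)) //; auto.
Qed.

Lemma env_set s X a v : env s -> X \notin env_names -> env (set_cell s X a v).
Proof.
move=> h XE; apply: (@env_untouched (predC1 X) s) => //.
  by apply: untouched_set => //=; rewrite eqxx.
by rewrite all_predC has_pred1.
Qed.

(* Slot j + 1 holds what is known of the constraint j once it is revealed.  Before
   that, the constraint is presented as the slot DEF: slot 0, which stands for a
   relation with all tuples, or that of the constraint revealed last. *)
Definition slot_of (s : state) (j : nat) : nat :=
  if mem s REP [:: j] == 0 then scalar s DEF else mem s REP [:: j].

(* Cells of ET hold the successors of indices into the list of all tuples; 0
   stands for the position itself, so that the fresh array lists all tuples. *)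
Definition entry (s : state) (z r : nat) : nat :=
  if mem s ET [:: z; r] == 0 then r else (mem s ET [:: z; r]).-1.

(** [RM] counts the removed tuples, not the remaining ones, so that memory consisting of zeros
    describes the full list. *)
Record lists (s : state) (z : nat) (e : seq nat) : Prop := Lists {
  lists_size : mem s RM [:: z] = N - size e;
  lists_uniq : uniq e;
  lists_lt : all (gtn N) e;
  lists_entry : forall r, r < size e -> entry s z r = nth 0 e r
}.

Lemma lists_le s z e : lists s z e -> size e <= N.
Proof.
move=> [_ ue le _]; rewrite -(size_iota 0 N); apply: uniq_leq_size ue _.
by move=> r re; rewrite mem_iota /=; exact: (allP le).
Qed.

Lemma find_entry_ok O' s z r out :
  scalar s ONE = 1 -> out != ONE -> out != r ->
  wp O' inp (find_entry z r out) s (fun t s' => t <= 3 /\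
    scalar s' out = entry s (scalar s z) (scalar s r) /\
    untouched (predC1 out) s s' /\ outp s' = outp s).
Proof.
move=> s1 o1 oR; rewrite /find_entry; step; step.
have un v : untouched (predC1 out) s (set_cell s out [::] v).
  by apply: untouched_set => //=; rewrite eqxx.
have un2 v v' : untouched (predC1 out) s (set_cell (set_cell s out [::] v) out [::] v').
  by apply: untouched_set => //=; rewrite eqxx.
rewrite /entry /=; apply: wp_if; rewrite {1}/scalar /= eqxx /= => v0; step.
  split=> //; split; last by split.
  rewrite {1}/scalar /= eqxx /= (negPf v0).
  rewrite {1}/scalar /= eqxx /= {1}/scalar /= [_ == out]eq_sym (negPf o1) /=.
  by rewrite -[mem s 0 _]/(scalar s 0) s1 subn1.
split=> //; split; last by split.
rewrite {1}/scalar /= eqxx /= v0 /=.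
by rewrite eq_sym (negPf oR).
Qed.

Definition inpA (s : state) : store := fun f a =>
  match f, a with
  | 0, _ => inp 0 a
  | 1, [:: _; i] => i
  | 2, [:: j] => mem s KA [:: slot_of s j]
  | 3, [:: j; _] => N - mem s RM [:: slot_of s j]
  | 4, [:: j; r; i] => mem s G [:: q; entry s (slot_of s j) r; i]
  | _, _ => 0
  end.

Definition inpD (s : state) (k r : nat) : store := fun f a =>
  match f, a with
  | 0, _ => inp 0 a
  | 1, [:: i] => mem s QA [:: mem s G [:: q; r; i]]
  | 2, [::] => k
  | _, _ => 0
  end.

Lemma spare_callA z : z \in [:: T1; T2] -> spare nuA OUT CNT prot_sub z.
Proof. by rewrite !inE => /orP[] /eqP ->; split=> // X; rewrite /nuA; lia. Qed.

Lemma spare_callD z : z \in [:: T1; T2] -> spare nuD OUT CNT prot_sub z.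
Proof. by rewrite !inE => /orP[] /eqP ->; split=> // X; rewrite /nuD; lia. Qed.

Notation simA V := (sim nuA OUT CNT V prot_sub).
Notation simD V := (sim nuD OUT CNT V prot_sub).

Lemma find_slot_ok V s0 s s' j : simA V s0 s s' -> j \in V ->
  wp O inp (find_slot (nuA j)) s' (fun t s1 =>
    [/\ t <= 3, simA V s0 s s1 & scalar s1 T1 = slot_of s0 (scalar s j)]).
Proof.
move=> h Vj; rewrite /find_slot; step; step.
have e : mem s' REP (subscripts s' [:: nuA j]) = mem s0 REP [:: scalar s j].
  by rewrite /= (sim_scalar h) // (sim_prot h).
rewrite e /slot_of; set v := mem s0 REP _.
have h1 w : simA V s0 s (set_cell s' T1 [::] w).
  by apply: sim_spare h; exact: spare_callA.
apply: wp_if; rewrite {1}/scalar /= => v0; step; split=> //.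
- by rewrite (negPf v0).
- by apply: sim_spare (h1 _); exact: spare_callA.
- by norm; rewrite v0 eqxx (untouched_scalar (sim_prot h)).
Qed.

Lemma readA_ok V s0 s s' x f (ys : seq nat) : env s0 ->
  simA V s0 s s' -> x \in V -> {subset ys <= V} ->
  wp O inp (readA (nuA x) f (map nuA ys)) s' (fun t s1 =>
    t + 1 <= 9 /\ simA V s0
      (set_cell s x [::] (inpA s0 f (subscripts s ys))) s1).
Proof.
move=> E0 h Vx Vy.
have sy := sim_subscripts h Vy.
have st := @sim_set _ _ _ _ _ V prot_sub s0 layout_callA.
have zero : wp O inp (Const (nuA x) 0) s'
    (fun t s1 => t + 1 <= 9 /\ (simA V s0 (set_cell s x [::] 0) s1)).
  by step; split=> //; exact: st.
case: f => [|[|[|[|[|f]]]]].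
- by rewrite /=; step; rewrite sy; split=> //; apply: st.
- case: ys Vy sy => [|j [|i [|? ys]]] Vy sy; try exact: zero.
  by rewrite /=; step; split=> //=; case: sy => _ <-; exact: st.
- case: ys Vy sy => [|j [|i ys]] Vy sy; try exact: zero.
  rewrite /=; step; apply: wp_mono.
    by apply: (find_slot_ok h); rewrite Vy // inE.
  move=> t s1 [tle h1 sl]; step; split; first by lia.
  by rewrite /= sl (sim_prot h1) //; exact: st.
- case: ys Vy sy => [|j [|i [|? ys]]] Vy sy; try exact: zero.
  rewrite /=; step; apply: wp_mono.
    by apply: (find_slot_ok h); rewrite Vy // inE eqxx.
  move=> t s1 [tle h1 sl]; step; step; step; split; first by lia.
  norm; rewrite sl !(sim_prot h1) // (untouched_scalar (sim_prot h1)) //.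
  rewrite (env_number E0).
  by apply: st; apply: sim_spare h1; exact: spare_callA.
- case: ys Vy sy => [|j [|r [|i [|? ys]]]] Vy sy; try exact: zero.
  rewrite /=; step; apply: wp_mono.
    by apply: (find_slot_ok h); rewrite Vy // inE eqxx.
  move=> t s1 [tle h1 sl]; step; apply: wp_mono.
    apply: find_entry_ok => //; last by rewrite /nuA; lia.
    by rewrite (untouched_scalar (sim_prot h1)) // (env_one E0).
  move=> t2 s2 [t2le [e2 [u2 o2]]]; step; split; first by lia.
  have h2 : simA V s0 s s2.
    apply: (sim_untouched h1 u2) => //.
      by move=> Z; rewrite /nuA /=; lia.
    by move=> Z /andP[_]; rewrite /= !inE; lia.
  rewrite /= (sim_prot h2) // !(sim_scalar h2) ?Vy ?inE ?eqxx ?orbT //.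
  rewrite (untouched_scalar (sim_prot h2)) // (env_arity E0) e2 sl.
  rewrite (sim_scalar h1) ?Vy ?inE ?eqxx ?orbT //.
  have -> z w : entry s1 z w = entry s0 z w by rewrite /entry (sim_prot h1).
  exact: st.
- by case: f ys Vy sy => [|f] [|? [|? [|? [|? ?]]]] Vy sy; exact: zero.
Qed.

Lemma readD_ok V s0 s s' x f (ys : seq nat) : env s0 ->
  simD V s0 s s' -> x \in V -> {subset ys <= V} ->
  wp O inp (readD (nuD x) f (map nuD ys)) s' (fun t s1 =>
    t + 1 <= 9 /\ simD V s0
      (set_cell s x [::] (inpD s0 (scalar s0 KC) (scalar s0 CUR) f
         (subscripts s ys))) s1).
Proof.
move=> E0 h Vx Vy.
have sy := sim_subscripts h Vy.
have st := @sim_set _ _ _ _ _ V prot_sub s0 layout_callD.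
have zero : wp O inp (Const (nuD x) 0) s'
    (fun t s1 => t + 1 <= 9 /\ (simD V s0 (set_cell s x [::] 0) s1)).
  by step; split=> //; exact: st.
case: f => [|[|[|f]]].
- by rewrite /=; step; rewrite sy; split=> //; apply: st.
- case: ys Vy sy => [|i [|? ys]] Vy sy; try exact: zero.
  rewrite /=; step; step; step; split; first by lia.
  norm; rewrite !(sim_prot h) // (untouched_scalar (sim_prot h) (X := Q)) //.
  rewrite (untouched_scalar (sim_prot h) (X := CUR)) //.
  rewrite (env_arity E0) (sim_scalar h) ?Vy ?inE ?eqxx //.
  by apply: st; apply: sim_spare h; exact: spare_callD.
- case: ys Vy sy => [|i ys] Vy sy; last exact: zero.
  rewrite /=; step; split=> //.
  by rewrite /= -[mem s' KC [::]]/(scalar s' KC) (untouched_scalar (sim_prot h)) //; exact: st.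
- by case: ys Vy sy => [|? ?] Vy sy; exact: zero.
Qed.

Definition presented (k : 'I_m -> 'I_(nrel (S n))) (e : 'I_m -> seq nat) :
    instance (ext_csp S n) m :=
  fun j => ext_constraint (k j) [set t in map at_ (e j)].

Lemma indices_of_nth (t : dtuple l q) (i : 'I_q) :
  nth 0 (indices_of t) i = tnth (val t) i.
Proof.
by rewrite (nth_map (tnth (val t) i)) ?size_tuple // -tnth_nth.
Qed.

Lemma lists_tuples s z e : env s -> lists s z e ->
  forall r (i : 'I_q), r < size e ->
    mem s G [:: q; entry s z r; val i] = tnth (val (at_ (nth 0 e r))) i.
Proof.
move=> E0 [_ _ le en] r i re; have rN : nth 0 e r < N.
  by have /allP/(_ _ (mem_nth 0 re)) := le.
rewrite en // (env_tuples E0) ?size_arrangements //; last exact: ltn_ord.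
by rewrite -(tuple_atE (arity_le (S n))) // indices_of_nth.
Qed.

Lemma lists_map_uniq s z e : lists s z e -> uniq (map at_ e).
Proof.
move=> [_ ue /allP le _]; rewrite map_inj_in_uniq // => x y /le xN /le yN.
exact: tuple_at_inj.
Qed.

(** The bound on [size out] is recorded because copying or emitting the output must cost no more
    than a multiple of [T]. *)
Lemma callA_ok s (k : 'I_m -> 'I_(nrel (S n))) (e : 'I_m -> seq nat) : env s ->
  (forall j : 'I_m, mem s KA [:: slot_of s j] = k j /\
                    lists s (slot_of s j) (e j)) ->
  exists out, [/\ correct_output (presented k e) out, size out <= T &
  wp O inp callA s (fun t s' =>
    [/\ t <= 9 * T + size (names A) + 2, buffered OUT CNT out s',
        untouched prot_sub s s' & outp s' = outp s])].
Proof.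
move=> E0 ke.
have [|out r oP] := A_ok (C' := presented k e) (inp := inpA s).
  split=> [||j].
  - exact: enc.
  - by move=> j i /=; rewrite tnth_ord_tuple.
  have [kj ej] := ke j; exists (k j), (map at_ (e j)); split.
  - exact: ext_constraintE.
  - exact: lists_map_uniq ej.
  - exact: kj.
  - rewrite /= (lists_size ej) subKn ?size_map //; exact: lists_le ej.
  move=> r i; have re : r < size (e j) by rewrite -(size_map at_).
  rewrite /= (lists_tuples E0 ej) // (tnth_nth (at_ 0)) /=.
  by rewrite (nth_map 0).
exists out; split=> //.
  by case: r => t [s' [ex tT <-]]; exact: leq_trans (size_outp ex) tT.
apply: (@subroutine_ok nuA OUT CNT ONE DONE readA _ prot_sub s O (inpA s) inp 9 A T out) => //.
- exact: layout_callA.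
- exact: env_one.
- exact: env_done.
- by move=> s1 s2 x f ys h Vx Vy; apply: readA_ok.
Qed.

Lemma callD_ok s (k : 'I_(nrel (S n))) (a : assignment (S n)) r :
  env s -> scalar s KC = k -> scalar s CUR = r -> r < N ->
  (forall i : 'I_l, mem s QA [:: val i] = tnth a i) ->
  wp O inp callD s (fun t s' =>
    [/\ t <= 9 * c + size (names D) + 2,
        buffered OUT CNT [:: (project a (at_ r) \in rel k) : nat] s',
        untouched prot_sub s s' & outp s' = outp s]).
Proof.
move=> E0 sk sr rN sa.
apply: (@subroutine_ok nuD OUT CNT ONE DONE readD _ prot_sub s O (inpD s k r) inp 9 D c) => //.
- exact: layout_callD.
- exact: env_one.
- exact: env_done.
- by move=> s1 s2 x f ys h Vx Vy; rewrite -sk -sr; apply: readD_ok.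
apply: D_ok; split=> //; first exact: enc_params_sub enc.
move=> i; rewrite /= (env_tuples E0) ?size_arrangements ?ltn_ord //.
by rewrite -(tuple_atE (arity_le (S n))) // indices_of_nth sa tnth_mktuple.
Qed.

(** * Removing refuted tuples from a list *)

Definition prune_names : seq nat :=
  [:: T1; T2; OUT; CNT; R; dR; LEN; W; CUR; RES; Z1; RV; ET].

Definition prot_prune : pred nat :=
  [pred Z | (Z %% 3 == 0) && (Z \notin prune_names)].

Definition survivors (k : 'I_(nrel (S n))) (a : assignment (S n)) (e : seq nat) :=
  [seq r <- e | project a (at_ r) \notin rel k].

Lemma prune_loop_ok s0 z (k : 'I_(nrel (S n))) (a : assignment (S n)) e :
  env s0 -> scalar s0 SL = z -> scalar s0 KC = k ->
  scalar s0 LEN = size e -> scalar s0 W = 0 ->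
  (forall i : 'I_l, mem s0 QA [:: val i] = tnth a i) -> lists s0 z e ->
  wp O inp (For ONE R dR LEN prune_step) s0 (fun t s =>
    [/\ t <= size e * (9 * c + size (names D) + 14) + 3,
        scalar s W = size (survivors k a e),
        forall i, i < size (survivors k a e) -> entry s z i = nth 0 (survivors k a e) i,
        forall z' i, z' != z -> mem s ET [:: z'; i] = mem s0 ET [:: z'; i] &
        untouched prot_prune s0 s /\ outp s = outp s0]).
Proof.
move=> E0 sz sk sl sw sa le.
pose kept r := survivors k a (take r e).
apply: (@wp_for _ _ _ _ _ _ _ (fun r s =>
  [/\ scalar s W = size (kept r),
      forall i, i < size (kept r) -> entry s z i = nth 0 (kept r) i,
      (* The list is rewritten in place: at most [r] survivors have been written, so the entries
         still to be read are intact. *)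
      forall i, r <= i -> mem s ET [:: z; i] = mem s0 ET [:: z; i],
      forall z' i, z' != z -> mem s ET [:: z'; i] = mem s0 ET [:: z'; i] &
      untouched prot_prune s0 s /\ outp s = outp s0])
  (9 * c + size (names D) + 11) (size e)) => //; first exact: env_one.
- by rewrite /kept take0; split=> //; split=> //; do 2 ![apply: untouched_set => //].
- move=> r s re [w en hi ot [u o]] sr sdr s1.
  have es : env s by apply: (env_untouched E0 u).
  have ps Z : prot_prune Z -> scalar s Z = scalar s0 Z.
    by move=> pZ; rewrite (untouched_scalar u).
  rewrite /prune_step; step; apply: wp_mono; first exact: find_entry_ok.
  move=> t1 s2 [t1le [c2 [u2 o2]]].
  have es2 : env s2 by apply: (env_untouched es u2).
  have cE : scalar s2 CUR = nth 0 e r.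
    rewrite c2 ps // sr sz /entry hi // -(lists_entry le re) /entry //.
  have cN : nth 0 e r < N by have /allP/(_ _ (mem_nth 0 re)) := lists_lt le.
  step; apply: wp_mono.
    apply: (@callD_ok s2 k a _ es2 _ cE cN).
      by rewrite (untouched_scalar u2) // ps.
    by move=> i; rewrite u2 // u.
  move=> t3 s3 [t3le [_ b3] u3 o3].
  have es3 : env s3 by apply: (env_untouched es2 u3).
  have p3 Z : prot_sub Z && (Z != CUR) -> scalar s3 Z = scalar s Z.
    move=> /andP[pZ ZC].
    by rewrite (untouched_scalar u3) // (untouched_scalar u2).
  have ET3 b : mem s3 ET b = mem s ET b by rewrite u3 // u2.
  have c3 : scalar s3 CUR = nth 0 e r by rewrite (untouched_scalar u3) ?cE.
  have u03 : untouched prot_prune s0 s3.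
    apply: (untouched_trans u); apply: untouched_trans (untouched_sub _ u2)
      (untouched_sub _ u3) => Z; rewrite /prot_prune /prot_sub /= !inE; lia.
  have o03 : outp s3 = outp s0 by rewrite o3 o2.
  have kS : kept r.+1 = kept r ++
      (if project a (at_ (nth 0 e r)) \in rel k then [::] else [:: nth 0 e r]).
    rewrite /kept (take_nth 0 re) /survivors filter_rcons.
    by case: (_ \in _); rewrite ?cats0 ?cats1.
  step; step; rewrite /= (env_zero es3) b3 //=.
  have wr : size (kept r) <= r.
    rewrite /kept size_filter (leq_trans (count_size _ _)) // size_take_min.
    exact: geq_minl.
  apply: wp_if; rewrite {1}/scalar /=; case: (_ \in rel k) kS => // kS _.
    step; split=> //; norm; rewrite ?p3 //; first by lia.
    rewrite kS cats0; split=> //; norm; rewrite ?p3 //.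
    + by move=> i ik; rewrite -en // /entry /= ET3.
    + by move=> i ik; rewrite ET3 hi // ltnW.
    + by move=> z' i zz; rewrite ET3 ot.
    + by split=> //; do 3 ![apply: untouched_set => //].
  step; step; norm; rewrite c3 (env_one es3).
  step; step; norm; rewrite (p3 SL) // (p3 W) // ps // sz w.
  step; norm; rewrite (p3 W) // w (env_one es3).
  split=> //; norm; rewrite ?p3 //; first by lia.
  rewrite kS size_cat; split=> //; norm.
  + move=> i; rewrite addn1 ltnS leq_eqVlt nth_cat => /predU1P[->|ik].
      by rewrite ltnn subnn /entry /= eqxx /= addn1.
    rewrite ik -en // /entry /= !eqseq_cons (ltn_eqF ik) andbF /= ET3 //.
  + move=> i ri; have ki : size (kept r) < i by lia.
    by rewrite !eqseq_cons (gtn_eqF ki) andbF /= ET3 hi // ltnW.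
  + by move=> z' i zz; rewrite !eqseq_cons (negPf zz) ET3 ot.
  + by split=> //; do 6 ![apply: untouched_set => //].
- move=> t s tle; rewrite /kept take_size => -[w en _ ot uo]; split=> //; lia.
Qed.

Lemma prune_ok s0 z (k : 'I_(nrel (S n))) (a : assignment (S n)) e :
  env s0 -> scalar s0 SL = z -> scalar s0 KC = k ->
  (forall i : 'I_l, mem s0 QA [:: val i] = tnth a i) -> lists s0 z e ->
  wp O inp prune s0 (fun t s =>
    [/\ t <= N * (9 * c + size (names D) + 14) + 8,
        lists s z (survivors k a e),
        forall z' e', z' != z -> lists s0 z' e' -> lists s z' e',
        untouched [pred Z | prot_prune Z && (Z != RM)] s0 s & env s]).
Proof.
move=> E0 sz sk sa le; have eN := lists_le le.
rewrite /prune; step; step; norm; rewrite sz (lists_size le).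
step; step; norm; rewrite (env_number E0) subKn //.
step; step; step; set s1 := set_cell _ W _ _.
have E1 : env s1 by do 3 ![apply: env_set => //].
have u1 : untouched prot_prune s0 s1 by do 3 ![apply: untouched_set => //].
apply: wp_mono.
  by apply: (@prune_loop_ok s1 z k a e) => //; case: le.
move=> t s2 [tle w en ot [u2 o2]].
have E2 : env s2 by apply: (env_untouched E1 u2).
have u12 := untouched_trans u1 u2.
step; step; norm; rewrite (env_number E2) w.
step; norm; rewrite (untouched_scalar u12 (X := SL)) // sz.
split.
- have : size e * (9 * c + size (names D) + 14) <= N * (9 * c + size (names D) + 14).
    by rewrite leq_mul2r eN orbT.
  by lia.
- split=> //.
  + by rewrite /= eqxx.
  + exact: filter_uniq (lists_uniq le).
  + apply/allP => r; rewrite mem_filter => /andP[_].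
    exact: (allP (lists_lt le)).
- move=> z' e' zz [rm ue ae ee]; split=> //.
  + by rewrite /= eqseq_cons (negPf zz) /= -rm (u12 RM).
  + move=> r re; rewrite -ee // /entry /= ot //.
- do 2 ![apply: untouched_set => //].
  by apply: untouched_sub u12 => Z /andP[].
- by do 2 ![apply: env_set => //].
Qed.

(** * The invariant and the termination measure of the main loop *)

Record inv (s : state) (kn : 'I_m -> bool) (e : 'I_m -> seq nat)
    (k0 : 'I_(nrel (S n))) : Prop := Inv {
  inv_env : env s;
  inv_rep : forall j : 'I_m, mem s REP [:: val j] = if kn j then j.+1 else 0;
  inv_kind : forall j : 'I_m, kn j -> mem s KA [:: j.+1] = (C j).1;
  inv_lists : forall j : 'I_m, lists s j.+1 (e j);
  inv_true : forall j, exists2 r, r \in e j & at_ r = (C j).2;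
  inv_kind0 : mem s KA [:: 0] = k0;
  inv_lists0 : lists s 0 (iota 0 N);
  inv_empty : val k0 != 0 -> exists2 k, k != k0 & rel k = set0;
  inv_def : (scalar s DEF = 0 /\ forall j, ~~ kn j) \/
            exists2 j, kn j & scalar s DEF = (val j).+1
}.

Lemma lists_untouched (P : pred nat) s s' z e : lists s z e ->
  untouched P s s' -> P RM -> P ET -> lists s' z e.
Proof.
move=> [rm ue ae ee] u pR pE; split=> //; first by rewrite u.
by move=> r re; rewrite -ee // /entry !u.
Qed.

Lemma inv_untouched (P : pred nat) s s' kn e k0 : inv s kn e k0 ->
  untouched P s s' -> all P ([:: REP; KA; RM; ET; DEF] ++ env_names) ->
  outp s' = outp s -> inv s' kn e k0.
Proof.
move=> [E0 hr hk hl ht h0 l0 he hd] u.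
rewrite all_cat => /andP[/and5P[pr pk pR pE /andP[pd _]] Pe] o.
split=> //.
- exact: (env_untouched E0 u).
- by move=> j; rewrite u.
- by move=> j kj; rewrite u // hk.
- by move=> j; apply: lists_untouched (hl j) u _ _.
- by rewrite u.
- exact: lists_untouched l0 u _ _.
- by rewrite (untouched_scalar u).
Qed.

Definition default s (kn : 'I_m -> bool) (e : 'I_m -> seq nat)
    (k0 kd : 'I_(nrel (S n))) (ed : seq nat) : Prop :=
  [/\ scalar s DEF = 0, forall j, ~~ kn j, kd = k0 & ed = iota 0 N] \/
  exists j, [/\ kn j, scalar s DEF = (val j).+1, kd = (C j).1 & ed = e j].

Lemma inv_default s kn e k0 : inv s kn e k0 ->
  exists kd ed, default s kn e k0 kd ed.
Proof.
move=> /inv_def[[d0 kn0]|[j kj dj]]; first by exists k0, (iota 0 N); left.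
by exists (C j).1, (e j); right; exists j.
Qed.

Definition shown (kn : 'I_m -> bool) kd (j : 'I_m) : 'I_(nrel (S n)) :=
  if kn j then (C j).1 else kd.

Definition shown_list (kn : 'I_m -> bool) (e : 'I_m -> seq nat) ed (j : 'I_m) :=
  if kn j then e j else ed.

Lemma inv_shown s kn e k0 kd ed : inv s kn e k0 -> default s kn e k0 kd ed ->
  forall j : 'I_m, mem s KA [:: slot_of s j] = shown kn kd j /\
    lists s (slot_of s j) (shown_list kn e ed j).
Proof.
move=> h hd j; rewrite /slot_of (inv_rep h) /shown /shown_list.
case kj : (kn j) => /=.
  by split; [exact: inv_kind h _ kj | exact: (inv_lists h)].
case: hd => [[-> _ -> ->]|[i [ki -> -> ->]]].
  by split; [exact: inv_kind0 h | exact: (inv_lists0 h)].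
by split; [exact: inv_kind h _ ki | exact: (inv_lists h)].
Qed.

(** Each round that does not finish removes a listed tuple, reveals a constraint, or replaces R_0 by
    R_1 as the initial default; the last summand accounts for that single replacement. *)
Definition measure (kn : 'I_m -> bool) (e : 'I_m -> seq nat)
    (k0 : 'I_(nrel (S n))) : nat :=
  \sum_j (size (e j) + ~~ kn j) + (val k0 == 0).

Definition final (s : state) : Prop :=
  env s /\ exists out, [/\ buffered OUT CNT out s, size out <= T &
                          correct_output C out].

Definition progress s kn e k0 : Prop :=
  (scalar s GO = 0 /\ final s) \/
  (scalar s GO != 0 /\ exists kn' e' k0', inv s kn' e' k0' /\
     measure kn' e' k0' < measure kn e k0).

Lemma buffered_untouched (P : pred nat) out s s' : buffered OUT CNT out s ->
  untouched P s s' -> P OUT -> P CNT -> buffered OUT CNT out s'.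
Proof.
move=> [bc b] u po pc; split; first by rewrite (untouched_scalar u).
by move=> i il; rewrite u // b.
Qed.

(** Once a constraint has been revealed, every presented constraint copies a revealed one, whose
    list still contains its true tuple. So the solutions of [C] solve the presented instance. *)
Lemma presented_true s kn e k0 kd ed (a : assignment (S n)) j : inv s kn e k0 ->
  default s kn e k0 kd ed -> satisfies C a -> kn j || (scalar s DEF != 0) ->
  sat_constraint (presented (shown kn kd) (shown_list kn e ed) j) a.
Proof.
move=> h hd [aW aC] kj; rewrite sat_ext_constraint; apply/rel_unionP; split=> //.
rewrite /shown /shown_list; have [i [ki ei]] : exists i,
   (if kn j then (C j).1 else kd) = (C i).1 /\
   (if kn j then e j else ed) = e i.
  case: (kn j) kj => [_|/= d0]; first by exists j.
  by case: hd d0 => [[-> //]|[i [ki _ -> ->]]] _; exists i.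
rewrite ki ei; have [r re er] := inv_true h i.
by exists (at_ r); [exact: map_f | rewrite er; exact: aC].
Qed.

(** After a constraint has been revealed, a negative answer carries over to [C]. Before that it
    shows that the default relation is empty. For R_0 the loop goes on with R_1, or, if R_0 is the
    only relation, every constraint is unsatisfiable. For R_1 it would give two distinct empty
    relations. *)
Lemma no_solution_ok s kn e k0 kd ed : 0 < m -> inv s kn e k0 ->
  default s kn e k0 kd ed -> scalar s GO != 0 -> 0 < T ->
  buffered OUT CNT [:: 0] s ->
  (forall a, ~ satisfies (presented (shown kn kd) (shown_list kn e ed)) a) ->
  wp O inp no_solution s (fun t s' => t <= 7 /\ progress s' kn e k0).
Proof.
move=> m0 h hd go T0 b none.
have stop s' : untouched (off [:: GO; X]) s s' -> outp s' = outp s ->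
    scalar s' GO = 0 -> (forall a, ~ satisfies C a) -> progress s' kn e k0.
  move=> u o g no; left; split=> //.
  split; first by apply: (env_untouched (inv_env h) u).
  exists [:: 0]; split=> //; first exact: buffered_untouched b u _ _.
  by right.
rewrite /no_solution; apply: wp_if => d0.
  step; split=> //; apply: stop => //; first by apply: untouched_set.
  move=> a aC; apply: (none a); split; first by case: aC.
  by move=> j; apply: presented_true h hd aC _; rewrite d0 orbT.
have [_ kn0 ekd eed] : [/\ scalar s DEF = 0, forall j, ~~ kn j, kd = k0 & ed = iota 0 N].
  by case: hd => // -[j [_ dj _ _]]; rewrite dj in d0.
subst kd ed; have empty0 : rel k0 = set0.
  apply: (@rel_empty _ k0 (map at_ (iota 0 N))).
    move=> t; have [r rN <-] := tuple_at_onto (arity_le (S n)) t.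
    by apply: map_f; rewrite mem_iota.
  move=> a; apply/negP => ae; apply: (none a); split; first by case/rel_unionP: ae.
  move=> j; rewrite sat_ext_constraint /shown /shown_list.
  by rewrite (negPf (kn0 j)).
step; step; norm; rewrite (env_zero (inv_env h)) (inv_kind0 h).
apply: wp_if; rewrite {1}/scalar /= => k00.
  have [k kk0 ek] := inv_empty h k00.
  by move: kk0; rewrite (rel_inj (etrans ek (esym empty0))) eqxx.
step; step; norm; rewrite (env_two (inv_env h)) (env_nrel (inv_env h)).
apply: wp_if; rewrite {1}/scalar /=; case: leqP => // n2 _.
  step; norm; rewrite (env_zero (inv_env h)) (env_one (inv_env h)).
  split=> //; right; split=> //.
  exists kn, e, (Ordinal n2); split; last by rewrite /measure /= k00 ltn_add2l.
  set s' := set_cell _ KA _ _.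
  have u : untouched (off [:: X; KA]) s s' by do 3 ![apply: untouched_set => //].
  split.
  - exact: env_untouched (inv_env h) u _ _.
  - by move=> j; rewrite u // (inv_rep h).
  - by move=> j kj; rewrite /= (inv_kind h).
  - by move=> j; apply: lists_untouched (inv_lists h j) u _ _.
  - exact: inv_true h.
  - by [].
  - exact: lists_untouched (inv_lists0 h) u _ _.
  - by move=> _; exists k0 => //; apply/eqP => /(congr1 val); rewrite /= k00.
  - by rewrite (untouched_scalar u) //; exact: inv_def h.
step; split=> //; apply: stop => //; first by do 3 ![apply: untouched_set => //].
move=> a [_ /(_ (Ordinal m0))]; rewrite /sat_constraint.
suff -> : (C (Ordinal m0)).1 = k0 by rewrite empty0 inE.
apply: val_inj; have := ltn_ord (C (Ordinal m0)).1; rewrite /= k00.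
by lia.
Qed.

Lemma measure_lt kn e k0 kn' e' (j : 'I_m) :
  (forall i, i != j -> kn' i = kn i /\ e' i = e i) ->
  size (e' j) + ~~ kn' j < size (e j) + ~~ kn j ->
  measure kn' e' k0 < measure kn e k0.
Proof.
move=> same less; rewrite /measure ltn_add2r (bigD1 j) //= [in ltnRHS](bigD1 j) //=.
rewrite (eq_bigr (fun i => size (e i) + ~~ kn i)) ?ltn_add2r // => i ij.
by have [-> ->] := same i ij.
Qed.

Lemma size_survivors k (a : assignment (S n)) e :
  size (survivors k a e) <= size e ?= iff all (fun r => project a (at_ r) \notin rel k) e.
Proof.
by split; rewrite size_filter ?count_size // all_count.
Qed.

Lemma prune_inv s1 s2 kn e k0 (j : 'I_m) (a : assignment (S n)) :
  inv s1 kn e k0 -> ~~ sat_constraint (C j) a -> env s2 ->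
  (forall i : 'I_m, mem s2 REP [:: val i] = if i == j then j.+1 else mem s1 REP [:: val i]) ->
  (forall z, mem s2 KA [:: z] = if z == j.+1 then (C j).1 : nat else mem s1 KA [:: z]) ->
  scalar s2 DEF = j.+1 ->
  lists s2 j.+1 (survivors (C j).1 a (e j)) ->
  (forall z e', z != j.+1 -> lists s1 z e' -> lists s2 z e') ->
  inv s2 (fun i => (i == j) || kn i)
    (fun i => if i == j then survivors (C j).1 a (e j) else e i) k0.
Proof.
move=> h ja E2 r2 k2 d2 lj lo; split=> //.
- by move=> i; rewrite r2; case: eqP => [->|_] //; exact: inv_rep h i.
- move=> i; rewrite k2 eqSS -[_ == _ :> nat]/(i == j).
  by case: eqP => [->|_] //=; exact: inv_kind h i.
- move=> i; case: eqP => [->|/eqP ij] //.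
  by apply: lo (inv_lists h i); rewrite eqSS.
(* The true tuple of [j] survives because [a] violates the constraint [j] itself. *)
- move=> i; case: eqP => [->|_]; last exact: inv_true h i.
  have [r re er] := inv_true h j; exists r => //.
  by rewrite mem_filter re er ja.
- by rewrite k2 /=; exact: inv_kind0 h.
- exact: lo (inv_lists0 h).
- exact: inv_empty h.
- by right; exists j; rewrite ?eqxx.
Qed.

Lemma copy_answer_ok s (a : assignment (S n)) : env s ->
  buffered OUT CNT (1 :: vals a) s ->
  wp O inp
    (For ONE I dI L
      (Seq (Op Add I1 I ONE) (Seq (Get X OUT [:: I1]) (Put QA [:: I] X)))) s
    (fun t s' => [/\ t <= 6 * l + 3, forall i : 'I_l, mem s' QA [:: val i] = tnth a i,
       untouched (off [:: I; dI; I1; X; QA]) s s' & outp s' = outp s]).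
Proof.
move=> E0 [_ b].
apply: (@wp_for _ _ _ _ _ _ _ (fun k s' =>
  [/\ forall i, i < k -> mem s' QA [:: i] = nth 0 (vals a) i,
     untouched (off [:: I; dI; I1; X; QA]) s s' & outp s' = outp s]) 3 l) => //.
- exact: env_one.
- exact: env_len.
- by split=> //; do 2 ![apply: untouched_set => //].
- move=> k s' kl [g u o] si sd s1.
  have kb : mem s' OUT [:: k.+1] = nth 0 (vals a) k.
    by rewrite u // b //= size_vals ltnS.
  step; step; norm; rewrite si s1 addn1.
  step; step; norm; rewrite kb.
  step; norm; rewrite si; split=> //; split=> //; last first.
    by do 5 ![apply: untouched_set => //].
  move=> i; rewrite ltnS leq_eqVlt /= => /predU1P[->|ik]; first by rewrite eqxx.
  by rewrite eqseq_cons (ltn_eqF ik) /= g.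
- move=> t s' tle [g u o]; split=> //; first by lia.
  by move=> i; rewrite g ?vals_nth ?ltn_ord.
Qed.

Lemma ask_ok s kn e k0 kd ed (a : assignment (S n)) : inv s kn e k0 ->
  default s kn e k0 kd ed -> scalar s GO != 0 -> l < T ->
  buffered OUT CNT (1 :: vals a) s ->
  satisfies (presented (shown kn kd) (shown_list kn e ed)) a ->
  wp O inp ask s (fun t s' =>
    t <= 6 * l + N * (9 * c + size (names D) + 14) + 25 /\ progress s' kn e k0).
Proof.
move=> h hd go lT b [aW aE]; rewrite /ask; step; apply: wp_mono.
  exact: copy_answer_ok (inv_env h) b.
move=> t s1 [tle qa u1 o1].
have h1 : inv s1 kn e k0 by apply: (inv_untouched h u1).
have E1 := inv_env h1.
have qw : query_word s1 QA L = vals a.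
  apply: (@eq_from_nth _ 0); rewrite size_map size_iota (env_len E1) ?size_vals //.
  move=> i il; rewrite [LHS](nth_map 0) ?size_iota ?(env_len E1) // nth_iota //.
  by rewrite add0n -[i]/(val (Ordinal il)) qa vals_nth.
have [ans tr oa] := (O_ok (hist s1) (query_word s1 QA L)).1 a aW qw.
step; apply: wp_query; first exact: oa.
step; step; norm; rewrite (env_zero E1).
set s2 := set_array _ Y _.
have u2 v : untouched (off [:: Y; X]) s1 (set_cell s2 X [::] v).
  move=> Z; rewrite /= !inE !negb_or => /andP[/negPf ZY /negPf ZX] b'.
  by rewrite ZX ZY.
case: ans tr {oa} @s2 u2 => [j|] tr s2 u2; rewrite /array_of /=; last first.
  apply: wp_if; rewrite {1}/scalar //= => _; step; split; first by lia.
  left; split=> //; set s3 := set_cell _ GO _ _.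
  have u3 : untouched (off [:: I; dI; I1; X; QA; Y; GO]) s s3.
    apply: untouched_set => //; apply: untouched_trans (untouched_sub _ u1)
      (untouched_sub _ (u2 1)) => Z; rewrite /= !inE; lia.
  split; first by apply: (env_untouched (inv_env h) u3).
  exists (1 :: vals a); split.
  - exact: buffered_untouched b u3 _ _.
  - by rewrite /= size_vals.
  - by left; exists a.
apply: wp_if; rewrite {1}/scalar //= => _.
step; step; norm; rewrite (env_one E1) /=.
step; step; norm; rewrite (env_two E1) /=.
step; step; norm; rewrite (env_one E1) addn1.
step; step; norm. step; step; norm. step; step; norm.
set s3 := set_cell _ DEF _ _.
have u3 : untouched (off [:: Y; X; JJ; KC; SL; REP; KA; DEF]) s1 s3.
  do 6 ![apply: untouched_set => //].
  by apply: untouched_sub (u2 0) => Z; rewrite /= !inE; lia.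
have E3 : env s3 by apply: (env_untouched E1 u3).
apply: wp_mono.
  apply: (@prune_ok s3 j.+1 (C j).1 a (e j)) => //.
  exact: lists_untouched (inv_lists h1 j) u3 _ _.
move=> t4 s4 [t4le l4 lo4 u4 E4]; split; first by lia.
have u34 Z : prot_prune Z && (Z \notin [:: RM; Y; X; JJ; KC; SL; REP; KA; DEF]) ->
    forall b', mem s4 Z b' = mem s1 Z b'.
  move=> /andP[pZ]; rewrite inE negb_or => /andP[ZR Zn] b'.
  by rewrite u4 ?u3 //= pZ.
right; split.
  by rewrite /scalar u34 // -/(scalar _ _) (untouched_scalar u1).
exists (fun i => (i == j) || kn i),
  (fun i => if i == j then survivors (C j).1 a (e j) else e i), k0; split.
  apply: (@prune_inv s1 s4 kn e k0 j a) => //.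
  - move=> i; rewrite u4 //= eqseq_cons andbT -[_ == _ :> nat]/(i == j).
    by case: (i == j).
  - by move=> z; rewrite u4 //= eqseq_cons andbT; case: (z == _).
  - by rewrite (untouched_scalar u4).
  - move=> z e' zj lz; apply: lo4 => //.
    exact: lists_untouched lz u3 _ _.
apply: (@measure_lt _ _ _ _ _ j) => [i /negPf ij|]; first by rewrite ij.
rewrite eqxx /= addn0; have := size_survivors (C j).1 a (e j).
(* A new constraint lowers the measure by being revealed. For a known one, [a] satisfies its
   presented form, hence its relation at some listed tuple, and this tuple is removed. *)
case kj : (kn j) => le; last by rewrite addn1 ltnS le.
rewrite addn0 (ltn_leqif le); apply/allPn.
have := aE j; rewrite sat_ext_constraint /shown /shown_list kj.
case/rel_unionP=> _ [_ /mapP[r re ->] ra]; exists r => //.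
by rewrite negbK.
Qed.

(** [15 * T] is 9 T for the call and 6 l for copying the solution, where l < T because the solution
    was output within time T. *)
Definition iteration_bound : nat :=
  15 * T + size (names A) + N * (9 * c + size (names D) + 14) + 40.

Lemma iteration_ok s kn e k0 : 0 < m -> inv s kn e k0 -> scalar s GO != 0 ->
  wp O inp iteration s (fun t s' => t <= iteration_bound /\ progress s' kn e k0).
Proof.
move=> m0 h go; have [kd [ed hd]] := inv_default h.
have [out [oP oT ex]] := callA_ok (inv_env h) (inv_shown h hd).
rewrite /iteration; step; apply: wp_mono; first exact: ex.
move=> t s1 [tle b u o]; step; step; norm.
have h1 : inv s1 kn e k0 by apply: (inv_untouched h u).
rewrite (env_zero (inv_env h1)); set s2 := set_cell _ X _ _.
have u2 : untouched (off [:: X]) s1 s2 by apply: untouched_set.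
have h2 : inv s2 kn e k0 by apply: (inv_untouched h1 u2).
have hd2 : default s2 kn e k0 kd ed.
  by move: hd; rewrite /default -(untouched_scalar u (X := DEF)).
have b2 : buffered OUT CNT out s2 by exact: buffered_untouched b u2 _ _.
have go2 : scalar s2 GO != 0.
  by rewrite (untouched_scalar u2) // (untouched_scalar u).
have x2 : scalar s2 X = nth 0 out 0.
  rewrite /scalar /=; case: b => _ b; case: oP => [[a _ eo]|[_ eo]];
    by rewrite b ?eo.
apply: wp_if; rewrite x2; case: oP => [[a aP eo]|[none eo]]; rewrite eo // => _.
  rewrite eo in b2 oT; rewrite /= size_vals in oT.
  apply: wp_mono; first exact: (ask_ok h2 hd2 go2 oT b2 aP).
  by move=> t3 s3 [t3le p]; split=> //; rewrite /iteration_bound; lia.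
rewrite eo in b2 oT.
apply: wp_mono; first exact: (no_solution_ok m0 h2 hd2 go2 oT b2 none).
by move=> t3 s3 [t3le p]; split=> //; rewrite /iteration_bound; lia.
Qed.

Lemma prog_A_ok : 0 < m -> wp O inp prog_A init_state (fun t s =>
  t <= 330 * (N * N) + (m * N.+1 + 2) * iteration_bound.+1 + 5 * T + 20 /\
  correct_output C (outp s)).
Proof.
move=> m0; rewrite /prog_A.
step; step; step; step; step; step; norm; rewrite enc //=.
step; step; step; step; norm; rewrite enc //=.
step; step; step; step; norm; rewrite enc //=.
set s1 := set_cell _ SN _ _.
step; apply: wp_mono; first exact: (@enumerate_ok O inp l q s1 (arity_le (S n))).
move=> t s2 [tle nn st u o].
step; step; set s3 := set_cell _ GO _ _.
have u3 : untouched (off (GO :: enum_names)) s1 s3.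
  apply: untouched_set => //.
  by apply: untouched_sub u => Z; rewrite /= !inE !negb_or => /andP[].
have E3 : env s3.
  split=> //; try by rewrite (untouched_scalar u3).
have l3 z : lists s3 z (iota 0 N).
  split; rewrite ?size_iota ?subnn ?iota_uniq //; first by rewrite u3.
    by apply/allP => r; rewrite mem_iota.
  by move=> r rN; rewrite /entry u3 //= nth_iota.
(* R_0 exists since there is at least one constraint. *)
have n0 : 0 < nrel (S n) by case: (C (Ordinal m0)).1 => k kn; exact: leq_ltn_trans kn.
pose k0 := Ordinal n0.
have h3 : inv s3 xpred0 (fun _ => iota 0 N) k0.
  split=> //; try by move=> j; rewrite u3.
  - move=> j; have [r rN er] := tuple_at_onto (arity_le (S n)) (C j).2.
    by exists r; rewrite ?mem_iota.
  - by rewrite u3.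
  - by left; rewrite (untouched_scalar u3).
pose J i s := (scalar s GO != 0 -> exists kn e k0, inv s kn e k0 /\ measure kn e k0 < i)
  /\ (scalar s GO = 0 -> final s).
step; apply: (@wp_while _ _ _ _ J iteration_bound (m * N.+1 + 2)).
- move=> i s [jgo _] go; have [kn [e [k [h lt]]]] := jgo go.
  split; first by lia.
  apply: wp_mono; first exact: iteration_ok h go.
  move=> t4 s4 [t4le [[go4 f4]|[go4 [kn' [e' [k' [h' lt']]]]]]]; split=> //.
    by split=> //; rewrite go4.
  split=> [_|go0]; last by rewrite go0 in go4.
  by exists kn', e', k'; split=> //; lia.
- split=> // _; exists xpred0, (fun _ => iota 0 N), k0; split=> //.
  (* Initially all m lists are full, no constraint is revealed and R_0 is the default: the measure
     is m (N + 1) + 1. *)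
  rewrite /measure size_iota sum_nat_const card_ord addn1 /=; lia.
move=> t4 i s4 t4le [_ jf] go; have [E4 [out [b outT oP]]] := jf go.
apply: wp_mono.
  by case: b => bc b; apply: (@emit_array_ok _ _ ONE I dI T1 OUT CNT out s4) => //;
     exact: env_one.
move=> t5 s5 [t5le o5 _]; split; last by rewrite o5 (env_outp E4).
by lia.
Qed.

End HiddenFromExtension.

(** * The time bound of (a) *)

Lemma comp_gt0 (S : csp) n m (C : instance (S n) m) D c : 0 < m ->
  (forall (k : 'I_(nrel (S n))) (u : (arity (S n)).-tuple 'I_(alph (S n)))
     (inp : store), enc_membership (by_index S) k u inp ->
   runs_within no_oracle inp D c [:: (u \in rel k) : nat]) ->
  0 < c.
Proof.
move=> m0 D_ok; have [u _] := alph_inhab (S n) (arity (S n)).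
pose k := (C (Ordinal m0)).1.
pose inp : store := fun f a =>
  match f with
  | 0 => array_of (csp_params S n) a | 1 => array_of (vals u) a | _ => k
  end.
apply: (@runs_gt0 no_oracle inp D); apply: (D_ok k u); split=> //.
by move=> i; rewrite /= vals_nth.
Qed.

Lemma extension_to_hidden (S : csp) (T : nat -> nat -> nat) (cR : nat -> nat) :
  solvable_in_time (by_listing S) T -> comp_within (by_index S) cR ->
  exists c, hidden_solvable_in_time true false S
    (fun n m => c * ((T n m + ntuples S n * cR n) * m * ntuples S n)).
Proof.
move=> [A A_ok] [D D_ok].
(* 70 is 15 + 14 + 41, from the cost of one round with its loop test; the factor 4 comes from m (N +
   1) + 2 <= 4 m N; and 355 is 330 + 5 + 20, from the enumeration, the final output and the single
   steps. *)
exists (4 * (size (names A) + size (names D) + 70) + 355).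
exists (prog_A A D) => n m n0 m0 C O inp O_ok enc.
have DT := D_ok n n0; have c0 := comp_gt0 C m0 DT.
have [t [s [ex [tle oP]]]] := prog_A_ok O_ok enc (A_ok n m n0 m0) DT m0.
exists (outp s) => //; exists t, s; split=> //; apply: leq_trans tle _.
rewrite /iteration_bound /ntuples card_dtuple.
have N0 : 0 < len (S n) ^_ arity (S n) by rewrite ffact_gt0 arity_le.
move: (T n m) (cR n) c0 (size (names A)) (size (names D)) => t0 c c0 x y.
move: N0; move: (_ ^_ _) => N N0; set z := t0 + N * c.
have zN : N <= z by rewrite (leq_trans _ (leq_addl _ _)) // leq_pmulr.
have z0 : 0 < z by exact: leq_trans zN.
have h1 : (15 * t0 + x + N * (9 * c + y + 14) + 40).+1 <= (x + y + 70) * z.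
  have hx : x <= x * z by rewrite leq_pmulr.
  have hy : N * y <= y * z by rewrite mulnC leq_mul2l zN orbT.
  have e1 : N * (9 * c + y + 14) = 9 * (N * c) + N * y + 14 * N by lia.
  have e2 : (x + y + 70) * z = x * z + y * z + 70 * z by lia.
  have ez : z = t0 + N * c by [].
  by rewrite e1 e2; clearbody z; lia.
have mN0 : 0 < m * N by rewrite muln_gt0 m0.
have h2 : m * N.+1 + 2 <= 4 * (m * N).
  have : m <= m * N by rewrite leq_pmulr.
  by rewrite mulnS; lia.
have h3 := leq_mul h2 h1.
have h4 : N * N <= z * (m * N) by rewrite leq_mul // leq_pmull.
have h5 : z <= z * (m * N) by rewrite leq_pmulr.
have h6 : t0 <= z by exact: leq_addr.
have -> : z * m * N = z * (m * N) by rewrite mulnA.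
have e : (4 * (x + y + 70) + 355) * (z * (m * N)) =
         4 * (m * N) * ((x + y + 70) * z) + 355 * (z * (m * N)) by lia.
rewrite e; clearbody z; lia.
Qed.

Theorem theorem2 (S : csp) :
  (forall (T : nat -> nat -> nat) (compR : nat -> nat),
     solvable_in_time (by_listing S) T ->
     comp_within (by_index S) compR ->
     exists c : nat,
       hidden_solvable_in_time true false S
         (fun n m =>
            c * ((T n m + ntuples S n * compR n) * m * ntuples S n)))
  /\
  (forall (T : nat -> nat -> nat) (compER : nat -> nat),
     hidden_solvable_in_time true false S T ->
     comp_within (by_listing S) compER ->
     exists c : nat,
       solvable_in_time (by_listing S)
         (fun n m => c * (T n m * m * compER n))).
Proof.
by split=> T c; [exact: extension_to_hidden | exact: hidden_to_extension].
Qed.
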